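(* Let $C$ be a proper cone with nonempty interior $\operatorname{int}C$ in a real Banach space $(X,\|\cdot\|)$. Let $\psi\in C^*\setminus\{0\}$ and $\Sigma=\{x\in\operatorname{int}C\mid\psi(x)=1\}$. Let $G$ be a relatively open subset of $\Sigma$, and let $g:G\to\Sigma$ be a (norm-)continuous map that is nonexpansive with respect to Hilbert's projective metric $d$ (i.e. $d(g(x),g(y))\le d(x,y)$ for all $x,y\in G$). Assume that $v\in G$ is a fixed point of $g$. Assume that for some integer $n\ge1$: (A1) $g$ is semidifferentiable at $v$ with respect to $\psi^{-1}(0)$, with semidifferential $g'_v:\psi^{-1}(0)\to\psi^{-1}(0)$; (A2) there exists a relatively open neighborhood $U$ of $v$ in $\Sigma$, $U\subset G$, on which $g^n$ is defined, such that $g^n|_U$ is a $k$-set contraction with $k<1$ with respect to some homogeneous generalized measure of noncompactness on $X$; if $n>1$, assume also that $g'_v$ is uniformly continuous on bounded sets of $\psi^{-1}(0)$; (A3) the fixed point of $(g'_v)^n:\psi^{-1}(0)\to\psi^{-1}(0)$ is unique: if $x\in\psi^{-1}(0)$ and $x=(g'_v)^n(x)$, then $x=0$. Then $v$ is the only fixed point of $g^n$ in $G$ (and hence the only fixed point of $g$ in $G$): if $w\in G$ is such that $g^n(w)$ is defined and $g^n(w)=w$, then $w=v$.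
   Context: Iterates: $g^n$ denotes the $n$-th iterate of $g$, defined at those $x\in G$ for which $g(x),\dots,g^{n-1}(x)\in G$. Cones: a subset $C\subset X$ is a cone if $tC\subset C$ for all $t\ge0$. It is proper if it is closed, convex and pointed ($C\cap(-C)=\{0\}$); it then defines the partial order $x\le y\iff y-x\in C$. $C^*$ is the set of continuous linear forms $\psi$ on $X$ with $\psi(x)\ge0$ for all $x\in C$. Hilbert's projective metric: for $x,y\in\operatorname{int}C$, let $M(y/x)=\inf\{b\in\mathbb R\mid y\le bx\}$ and $m(y/x)=\sup\{a\in\mathbb R\mid ax\le y\}$; then $d(x,y)=\log M(y/x)-\log m(y/x)$. Semidifferentiability: a map $g:G\to Y$ ($G\subset X$, $v\in G$, $X,Y$ normed spaces) is semidifferentiable at $v$ with respect to a cone $K\subset X$ if $G$ contains a neighborhood of $v$ in $v+K$ and there is a continuous positively homogeneous map $h:K\to Y$ (i.e. $h(tx)=th(x)$ for $t>0$) such that $g(v+x)=g(v)+h(x)+o(\|x\|)$ as $x\to0$, $x\in K$. Such $h$ is unique and denoted $g'_v$. Measures of noncompactness: a homogeneous generalized measure of noncompactness on $X$ is a map $\nu$ from the bounded subsets of $X$ to $[0,\infty)$ such that for all bounded $A,B\subset X$ and real $\lambda$: $\nu(A)=0$ iff the closure of $A$ is compact; $\nu(A+B)\le\nu(A)+\nu(B)$; $\nu$ of the closed convex hull of $A$ equals $\nu(A)$; $\nu(\lambda A)=|\lambda|\nu(A)$; and $A\subset B$ implies $\nu(A)\le\nu(B)$. For a map $h:D\to X$,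 $D\subset X$, sending bounded sets to bounded sets, $\nu_D(h)=\inf\{\lambda>0\mid\nu(h(A))\le\lambda\nu(A)\text{ for all bounded }A\subset D\}$; $h$ is a $k$-set contraction with respect to $\nu$ ($k<1$) if $\nu_D(h)\le k$. *)

(* Defs.v *)
From HB Require Import structures.
From mathcomp Require Import all_boot all_order all_algebra.
From mathcomp Require Import all_classical all_reals all_analysis.

Set Implicit Arguments.
Unset Strict Implicit.
Unset Printing Implicit Defensive.

Import Order.TTheory GRing.Theory Num.Theory.
Import numFieldNormedType.Exports.

Local Open Scope classical_set_scope.
Local Open Scope ring_scope.

(* Partial maps D -> Y with D a subset of X are total functions X -> Y together
   with the set D; no definition below depends on their values outside D. *)

Section iterates.
Variables (T : Type) (G : set T) (g : T -> T).

Definition iter_dom (n : nat) : set T :=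
  [set x | G x /\ forall i : nat, (0 < i < n)%N -> G (iter i g x)].

End iterates.

Section cones.
Variables (R : realType) (X : normedModType R).
Implicit Types (C : set X) (x y : X).

Definition is_cone C := forall (t : R) x, 0 <= t -> C x -> C (t *: x).

Definition proper_cone C :=
  [/\ is_cone C, closed C, convex_set C & C `&` [set - x | x in C] = [set 0]].

Definition cone_le C x y := C (y - x).

Definition dual_cone C : set {linear X -> R^o} :=
  [set psi : {linear X -> R^o} |
    continuous psi /\ forall x, C x -> 0 <= psi x :> R].

(* For x, y in the interior of a proper cone C and x != 0, both sets are
   nonempty and bounded on the relevant side, and M and m are positive, so that
   the real-valued inf, sup and ln are the genuine ones. *)
Definition hilbert_M C y x : R := inf [set b : R | cone_le C y (b *: x)].

Definition hilbert_m C y x : R := sup [set a : R | cone_le C (a *: x) y].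

Definition hilbert_dist C x y : R :=
  ln (hilbert_M C y x) - ln (hilbert_m C y x).

Definition hilbert_nonexpansive C (G : set X) (g : X -> X) :=
  forall x y, G x -> G y -> hilbert_dist C (g x) (g y) <= hilbert_dist C x y.

Definition cone_section C (psi : X -> R) : set X :=
  C° `&` [set x | psi x = 1].

End cones.

Definition relatively_open (T : topologicalType) (A U : set T) :=
  U `<=` A /\ open (U : set (subspace A)).

Section semidifferential.
Variables (R : realType) (X Y : normedModType R).

Definition is_semidifferential (G : set X) (g : X -> Y) (v : X) (K : set X)
    (h : X -> Y) :=
  [/\ G v,
      \forall x \near within K (nbhs (0 : X)), G (v + x),
      {within K, continuous h},
      forall (t : R) (x : X), 0 < t -> K x -> h (t *: x) = t *: h x &
      (fun x : X => g (v + x)) =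
        (fun x : X => g v + h x) +o_ (within K (nbhs (0 : X))) (fun x : X => x)].

Definition unif_continuous_on_bounded (K : set X) (h : X -> Y) :=
  forall B : set X, B `<=` K -> bounded_set B ->
    unif_continuous (from_subspace B h).

End semidifferential.

Section noncompactness.
Variables (R : realType) (X : normedModType R).
Implicit Types (A B D : set X).

Definition closed_convex_hull A : set X :=
  smallest [set D : set X | closed D /\ convex_set D] A.

(* Only the values of nu on bounded sets are constrained. *)
Record homogeneous_noncompactness_measure (nu : set X -> R) : Prop := {
  ncm_ge0 : forall A, bounded_set A -> 0 <= nu A ;
  ncm_eq0 : forall A, bounded_set A -> nu A = 0 <-> compact (closure A) ;
  ncm_add : forall A B, bounded_set A -> bounded_set B ->
    nu [set a + b | a in A & b in B] <= nu A + nu B ;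
  ncm_hull : forall A, bounded_set A -> nu (closed_convex_hull A) = nu A ;
  ncm_scale : forall (l : R) A, bounded_set A ->
    nu [set l *: a | a in A] = `|l| * nu A ;
  ncm_le : forall A B, bounded_set A -> bounded_set B -> A `<=` B ->
    nu A <= nu B }.

(* Extended reals, so that the infimum of the empty set is +oo. *)
Definition ncm_map (nu : set X -> R) D (h : X -> X) : \bar R :=
  ereal_inf [set l%:E | l in [set l : R | 0 < l /\
    forall A, bounded_set A -> A `<=` D -> nu (h @` A) <= l * nu A]].

Definition set_contraction (nu : set X -> R) D (h : X -> X) (k : R) :=
  [/\ k < 1,
      forall A, bounded_set A -> A `<=` D -> bounded_set (h @` A) &
      (ncm_map nu D h <= k%:E)%E].

End noncompactness.

(* Main.v *)
Require Import Defs.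
From HB Require Import structures.
From mathcomp Require Import all_boot all_order all_algebra.
From mathcomp Require Import all_classical all_reals all_analysis.
From mathcomp Require Import ring lra.

Set Implicit Arguments.
Unset Strict Implicit.
Unset Printing Implicit Defensive.

Import Order.TTheory GRing.Theory Num.Theory.
Import numFieldNormedType.Exports.

Local Open Scope classical_set_scope.
Local Open Scope ring_scope.

(**
  Work with F = g^n, a map that does not increase Hilbert's metric d, and suppose
  that w <> v is another fixed point of F.  Straight segments are geodesics for
  d, so for p on the segment [v, w] the convex set
  S(p) = {x in Sigma | d(v,x) <= d(v,p), d(w,x) <= d(w,p)} stays away from v; it
  is mapped into itself by F, hence by T x = s F x + (1 - s) p for 0 <= s < 1,
  and T contracts d on S(p).

  The points of T-orbits starting at p, up to their exit from a small ball around
  v, lie in the sum of the hull of the image under F of the earlier points and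
  of a segment; as F is a k-set contraction they form a relatively compact set.
  If such orbits left the ball for p arbitrarily close to v, their exit points
  would cluster at a point at Hilbert distance 0 from v but not equal to v.  So
  some p works for all s, and the cluster points x of its T-orbits are fixed
  points of T, with |F x - x| = O(1 - s) and |x - v| bounded below.

  On the other hand F (v + x) = v + (g'_v)^n x + o(|x|) by the chain rule, and the
  set contraction property together with (A3) gives |F x - x| >= c |x - v| near v.
  Letting s tend to 1 yields a contradiction.
*)

(* [lincomb] proves equalities between linear combinations of vectors: both
   sides are reified, and the coefficients of each atom compared by [field]. *)
Inductive vexpr (R : Type) : Type :=
| VAtom of nat
| VZero
| VAdd of vexpr R & vexpr R
| VOpp of vexpr R
| VScale of R & vexpr R.
Arguments VAtom {R}.
Arguments VZero {R}.

Section linear_combinations.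
Variables (R : pzRingType) (V : lmodType R).

Fixpoint vexpr_eval (env : seq V) (e : vexpr R) : V :=
  match e with
  | VAtom i => nth 0 env i
  | VZero => 0
  | VAdd a b => vexpr_eval env a + vexpr_eval env b
  | VOpp a => - vexpr_eval env a
  | VScale c a => c *: vexpr_eval env a
  end.

Fixpoint vexpr_coef (e : vexpr R) (i : nat) : R :=
  match e with
  | VAtom j => if eqn j i then 1 else 0
  | VZero => 0
  | VAdd a b => vexpr_coef a i + vexpr_coef b i
  | VOpp a => - vexpr_coef a i
  | VScale c a => c * vexpr_coef a i
  end.

(** A nested conjunction rather than a quantified statement, so that [cbn] unfolds it into one
    scalar equation per atom. *)
Fixpoint vexpr_coef_eq (a b : vexpr R) (m : nat) : Prop :=
  if m is m'.+1 then
    vexpr_coef a m' = vexpr_coef b m' /\ vexpr_coef_eq a b m'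
  else True.

Lemma vexpr_evalE (env : seq V) (e : vexpr R) :
  vexpr_eval env e = \sum_(i < size env) vexpr_coef e i *: nth 0 env i.
Proof.
elim: e => /= [j||a -> b ->|a ->|c a ->].
- case: (ltnP j (size env)) => hj; last first.
    rewrite nth_default// big1// => i _.
    by case: (@eqnP j i) => [ji|_]; rewrite ?scale0r//; have := ltn_ord i; rewrite -ji ltnNge hj.
  rewrite (bigD1 (Ordinal hj))//= (introT eqnP)// scale1r big1 ?addr0// => i ij.
  case: (@eqnP j i) => [ji|_]; last by rewrite scale0r.
  by move: ij; rewrite -val_eqE /= ji eqxx.
- by rewrite big1// => i _; rewrite scale0r.
- by rewrite -big_split; apply: eq_bigr => i _; rewrite scalerDl.
- by rewrite -sumrN; apply: eq_bigr => i _; rewrite scaleNr.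
- by rewrite scaler_sumr; apply: eq_bigr => i _; rewrite scalerA.
Qed.

Lemma vexpr_eq (env : seq V) (a b : vexpr R) :
  vexpr_coef_eq a b (size env) -> vexpr_eval env a = vexpr_eval env b.
Proof.
move=> ab; rewrite !vexpr_evalE; apply: eq_bigr => i _; congr (_ *: _).
case: i => i /=; elim: (size env) ab => //= m IH [am abm].
by rewrite ltnS leq_eqVlt => /orP[/eqP ->|/(IH abm)].
Qed.

End linear_combinations.

Ltac vec_mem x env :=
  lazymatch env with
  | nil => constr:(false)
  | x :: _ => constr:(true)
  | _ :: ?t => vec_mem x t
  end.

Ltac vec_atoms env e :=
  lazymatch e with
  | @GRing.add _ ?a ?b => let env := vec_atoms env a in vec_atoms env b
  | @GRing.opp _ ?a => vec_atoms env a
  | @GRing.scale _ _ _ ?a => vec_atoms env a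
  | @GRing.zero _ => env
  | _ =>
    let m := vec_mem e env in
    lazymatch m with
    | true => env
    | false => constr:(e :: env)
    end
  end.

Ltac vec_index x env :=
  lazymatch env with
  | x :: _ => constr:(O)
  | _ :: ?t => let i := vec_index x t in constr:(S i)
  end.

Ltac vec_reify R env e :=
  lazymatch e with
  | @GRing.add _ ?a ?b =>
    let a' := vec_reify R env a in
    let b' := vec_reify R env b in constr:(@VAdd R a' b')
  | @GRing.opp _ ?a => let a' := vec_reify R env a in constr:(@VOpp R a')
  | @GRing.scale _ _ ?c ?a =>
    let a' := vec_reify R env a in constr:(@VScale R c a')
  | @GRing.zero _ => constr:(@VZero R)
  | _ => let i := vec_index e env in constr:(@VAtom R i)
  end.

Ltac lincomb_with R :=
  lazymatch goal with
  | |- @eq ?T ?a ?b =>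
    let env := vec_atoms (@nil T) a in
    let env := vec_atoms env b in
    let a' := vec_reify R env a in
    let b' := vec_reify R env b in
    refine (@vexpr_eq _ _ env a' b' _);
    cbn [vexpr_coef_eq vexpr_coef eqn size];
    repeat split
  end.

(** * The order defined by a proper cone *)

Lemma convex_set_comb (R : realType) (X : normedModType R) (A : set X)
    (s : R) (x y : X) : convex_set A -> A x -> A y -> 0 <= s -> s <= 1 ->
  A (s *: x + (1 - s) *: y).
Proof.
move=> convA Ax Ay s0 s1.
exact: set_mem (convA x y (Itv01 s0 s1) (mem_set Ax) (mem_set Ay)).
Qed.

Section cone_order.
Variables (R : realType) (X : normedModType R) (C : set X).
Hypothesis properC : proper_cone C.

Ltac lincomb := lincomb_with R.

Let cone_scale (t : R) (x : X) : 0 <= t -> C x -> C (t *: x).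
Proof. by case: properC => + _ _ _; exact. Qed.

(** Convexity gives the midpoint of the two multiples, and doubling it gives their sum. The equation
    for [z] is a premise so that membership goals reduce to identities for [lincomb]. *)
Lemma cone_comb (a b : R) (x y z : X) : C x -> C y -> 0 <= a -> 0 <= b ->
  z = a *: x + b *: y -> C z.
Proof.
move=> Cx Cy a0 b0 ->; have [_ _ convC _] := properC.
have h0 : 0 <= (2^-1 : R) by lra.
have h1 : (2^-1 : R) <= 1 by lra.
have := convex_set_comb convC (cone_scale a0 Cx) (cone_scale b0 Cy) h0 h1.
by move=> /(cone_scale (ler0n R 2)); congr C; lincomb; field.
Qed.

Lemma cone_scaled (a : R) (x z : X) : C x -> 0 <= a -> z = a *: x -> C z.
Proof. by move=> Cx a0 ->; exact: cone_scale. Qed.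

Lemma cone_antisym (x y : X) : C (x - y) -> C (y - x) -> x = y.
Proof.
move=> Cxy Cyx; have [_ _ _ CC] := properC.
suff: (C `&` [set - x | x in C]) (x - y) by rewrite CC => /eqP/[!subr_eq0]/eqP.
by split => //; exists (y - x) => //; rewrite opprB.
Qed.

Lemma cone_adherent (x : X) :
  (forall e, 0 < e -> exists2 y, C y & `|y - x| < e) -> C x.
Proof.
move=> Cx; have [_ clC _ _] := properC; apply: clC => B /nbhs_ballP[e /= e0 eB].
have [y Cy yx] := Cx e e0; exists y; split => //.
by apply: eB; rewrite -ball_normE /= distrC.
Qed.

Lemma cone_interiorP (x : X) :
  C° x -> exists2 r : R, 0 < r & forall y, `|y - x| < r -> C y.
Proof.
move=> /nbhs_ballP[r /= r0 rC]; exists r => // y yx; apply: rC.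
by rewrite -ball_normE /= distrC.
Qed.

Lemma cone_interior_absorb (x : X) : C° x ->
  exists2 r : R, 0 < r & forall y, `|y| < r -> C (x + y).
Proof.
move=> /cone_interiorP[r r0 rC]; exists r => // y yr; apply: rC.
by rewrite addrC addKr.
Qed.

(** A point [y] near [z] is [a] times the point [x + a^-1 (y - z)], which is near [x], plus the cone
    element [z - a x]. *)
Lemma cone_interior_add (a : R) (x z : X) :
  C° x -> 0 < a -> C (z - a *: x) -> C° z.
Proof.
move=> /cone_interiorP[r r0 rC] a0 Cz.
apply/nbhs_ballP; exists (a * r) => /=; first exact: mulr_gt0.
move=> y; rewrite -ball_normE /= => zy.
have /rC Cu : `|(x + a^-1 *: (y - z)) - x| < r.
  rewrite addrC addKr normrZ gtr0_norm ?invr_gt0// mulrC ltr_pdivrMr//.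
  by rewrite distrC mulrC.
by apply: (cone_comb Cu Cz (ltW a0) ler01); lincomb; field; rewrite gt_eqF.
Qed.

(** Passage to the limit in the order inequality [y' <= E x'] as [E] tends to 1, by closedness of
    the cone. *)
Lemma cone_limit (x y : X) :
  (forall e, 0 < e -> exists x' y' E, [/\ `|x' - x| < e, `|y' - y| < e,
    `|E - 1| < e & C (E *: x' - y')]) -> C (x - y).
Proof.
move=> H; apply: cone_adherent => e e0.
(* The four terms of the decomposition below have norms at most [d], [d |x|], [d] and [d], whence a
   factor slightly above [|x| + 3]. *)
pose d := Num.min 1 (e / (`|x| + 4)).
have N0 : 0 < `|x| + 4 by rewrite ltr_wpDl.
have d0 : 0 < d by rewrite lt_min ltr01 divr_gt0.
have d1 : d <= 1 by rewrite ge_min lexx.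
have de : d * (`|x| + 4) <= e by rewrite -ler_pdivlMr// ge_min lexx orbT.
have [x' [y' [E [xd yd Ed CE]]]] := H d d0.
exists (E *: x' - y') => //.
have -> : E *: x' - y' - (x - y) =
    (E - 1) *: (x' - x) + (E - 1) *: x + (x' - x) - (y' - y).
  by lincomb; ring.
apply: lt_le_trans de.
have t1 : `|(E - 1) *: (x' - x)| <= d.
  rewrite normrZ -[leRHS]mulr1; apply: ler_pM => //; first exact: ltW.
  by apply/ltW/(lt_le_trans xd).
have t2 : `|(E - 1) *: x| <= d * `|x|.
  by rewrite normrZ; apply: ler_wpM2r => //; exact: ltW.
have := ler_normB ((E - 1) *: (x' - x) + (E - 1) *: x + (x' - x)) (y' - y).
have := ler_normD ((E - 1) *: (x' - x) + (E - 1) *: x) (x' - x).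
have := ler_normD ((E - 1) *: (x' - x)) ((E - 1) *: x).
nra.
Qed.

End cone_order.

(* For [x, y] in the section this says that the exponential of their Hilbert
   distance is at most [E]; see [hilbert_bounds]. *)
Definition hilbert_le (R : realType) (X : normedModType R) (C : set X)
    (E : R) (x y : X) :=
  exists a b, [/\ 0 < a, b <= E * a, C (y - a *: x) & C (b *: x - y)].

(** * Hilbert's metric through order inequalities *)

Section hilbert_order.
Variables (R : realType) (X : normedModType R) (C : set X).
Variable psi : {linear X -> R^o}.
Hypotheses (properC : proper_cone C) (psiC : dual_cone C psi).
Local Notation S := (cone_section C psi).
Local Notation "x <=[ E ] y" := (hilbert_le C E x y)
  (at level 70, E at level 200).
Local Notation le_comb := (cone_comb properC).

Ltac lincomb := lincomb_with R.

Lemma section_interior (x : X) : S x -> C° x.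
Proof. by case. Qed.

Lemma section_cone (x : X) : S x -> C x.
Proof. by move=> /section_interior /interior_subset. Qed.

Lemma linear_form_comb (a b : R) (x y : X) :
  psi (a *: x + b *: y) = a * psi x + b * psi y :> R.
Proof. by rewrite linearD !linearZ. Qed.

Lemma section_le (a b : R) (x y : X) : S x -> S y -> C (a *: x - b *: y) ->
  b <= a.
Proof.
move=> [_ /= x1] [_ /= y1] /(psiC.2); rewrite -scaleNr linear_form_comb x1 y1.
by rewrite !mulr1 subr_ge0.
Qed.

Lemma section_conv (x y : X) (s : R) : S x -> S y -> 0 <= s <= 1 ->
  S (s *: x + (1 - s) *: y).
Proof.
move=> Sx Sy /andP[s0 s1]; split; last first.
  case: Sx Sy => [_ /= x1] [_ /= y1].
  by rewrite /= linear_form_comb x1 y1; ring.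
have [->|s_neq0] := eqVneq s 0.
  by rewrite scale0r add0r subr0 scale1r; exact: section_interior.
apply: (cone_interior_add properC (section_interior Sx) (a := s)).
  by rewrite lt_neqAle eq_sym s_neq0.
have s1' : 0 <= 1 - s by rewrite subr_ge0.
by apply: (cone_scaled properC (section_cone Sy) s1'); lincomb; ring.
Qed.

(** Since [psi] is 1 at both points, [a <= 1 <= b]; hence [E] bounds both [b] and [a^-1]. *)
Lemma hilbert_leW (E : R) (x y : X) : S x -> S y -> x <=[E] y ->
  [/\ 1 <= E, C (E *: y - x) & C (E *: x - y)].
Proof.
move=> Sx Sy [a [b [a0 bEa Ca Cb]]].
have a1 : a <= 1 by apply: (section_le Sy Sx); rewrite scale1r.
have b1 : 1 <= b by apply: (section_le Sx Sy); rewrite scale1r.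
have E1 : 1 <= E by nra.
have Ea1 : 0 <= E - a^-1.
  by rewrite subr_ge0 -(ler_pM2r a0) mulVf ?gt_eqF//; lra.
have Eb : 0 <= E - b by nra.
split => //.
- have ia : 0 <= a^-1 by rewrite invr_ge0 ltW.
  apply: (le_comb Ca (section_cone Sy) ia Ea1).
  by lincomb; field; rewrite gt_eqF.
- by apply: (le_comb Cb (section_cone Sx) ler01 Eb); lincomb; ring.
Qed.

Lemma hilbert_leE (a b E : R) (x y : X) : 0 < a -> b <= E * a ->
  C (y - a *: x) -> C (b *: x - y) -> x <=[E] y.
Proof. by move=> *; exists a, b. Qed.

Lemma hilbert_le_sym (E : R) (x y : X) : S x -> S y -> x <=[E] y -> y <=[E] x.
Proof.
move=> Sx Sy [a [b [a0 bEa Ca Cb]]].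
have b1 : 1 <= b by apply: (section_le Sx Sy); rewrite scale1r.
have b0 : 0 < b by lra.
apply: (@hilbert_leE b^-1 a^-1); rewrite ?invr_gt0//.
- by rewrite ler_pdivlMr// mulrC ler_pdivrMr.
- have ib : 0 <= b^-1 by rewrite invr_ge0 ltW.
  apply: (cone_scaled properC Cb ib); lincomb; field; rewrite gt_eqF//.
- have ia : 0 <= a^-1 by rewrite invr_ge0 ltW.
  apply: (cone_scaled properC Ca ia); lincomb; field; rewrite gt_eqF//.
Qed.

Lemma hilbert_le_trans (E F : R) (x y z : X) : S x -> S y -> S z ->
  x <=[E] y -> y <=[F] z -> x <=[E * F] z.
Proof.
move=> Sx Sy Sz [a [b [a0 bEa Ca Cb]]] [c [d [c0 dFc Cc Cd]]].
have d1 : 1 <= d by apply: (section_le Sy Sz); rewrite scale1r.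
have d0 : 0 <= d by lra.
apply: (@hilbert_leE (c * a) (d * b)); first exact: mulr_gt0.
- apply: (@le_trans _ _ (d * (E * a))); first by apply: ler_wpM2l.
  have b1 : 1 <= b by apply: (section_le Sx Sy); rewrite scale1r.
  have Ea : 0 <= E * a by lra.
  have := ler_wpM2r Ea dFc; nra.
- by apply: (le_comb Cc Ca ler01 (ltW c0)); lincomb; ring.
- by apply: (le_comb Cd Cb ler01 d0); lincomb; ring.
Qed.

(** Hilbert balls are convex: averaging the order inequalities for [x] and [y] averages their
    coefficients. *)
Lemma hilbert_le_conv (E s : R) (v x y : X) : 0 <= s <= 1 ->
  v <=[E] x -> v <=[E] y -> v <=[E] (s *: x + (1 - s) *: y).
Proof.
move=> /andP[s0 s1] [a [b [a0 bEa Ca Cb]]] [c [d [c0 dFc Cc Cd]]].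
have s1' : 0 <= 1 - s by lra.
apply: (@hilbert_leE (s * a + (1 - s) * c) (s * b + (1 - s) * d)).
- have [->|s0'] := eqVneq s 0; first by lra.
  by apply: ltr_wpDr; [exact: mulr_ge0 (ltW _)|rewrite mulr_gt0// lt0r s0'].
- by have := ler_wpM2l s0 bEa; have := ler_wpM2l s1' dFc; lra.
- by apply: (le_comb Ca Cc s0 s1'); lincomb; ring.
- by apply: (le_comb Cb Cd s0 s1'); lincomb; ring.
Qed.

Lemma hilbert_le_near (E : R) (v : X) : S v -> 1 < E ->
  exists2 r : R, 0 < r & forall x, `|x - v| < r -> v <=[E] x.
Proof.
move=> /section_interior/(cone_interior_absorb)[r r0 rC] E1.
(* Chosen so that [(1 + e) / (1 - e) = E]; on the ball of radius [e r] one has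
   [(1 - e) v <= x <= (1 + e) v]. *)
pose e := (E - 1) / (E + 1).
have e0 : 0 < e by rewrite divr_gt0//; lra.
have e1 : 1 + e = E * (1 - e) by rewrite /e; field; lra.
have e1' : e < 1 by rewrite /e ltr_pdivrMr//; lra.
exists (e * r) => [|x xv]; first exact: mulr_gt0.
have xvr : `|e^-1 *: (x - v)| < r.
  by rewrite normrZ gtr0_norm ?invr_gt0// mulrC ltr_pdivrMr// mulrC.
have Cp := rC _ xvr.
have Cm : C (v + - (e^-1 *: (x - v))) by apply: rC; rewrite normrN.
apply: (@hilbert_leE (1 - e) (1 + e)); rewrite ?e1//; first by lra.
- by apply: (cone_scaled properC Cp (ltW e0)); lincomb; field; rewrite gt_eqF.
- rewrite -e1; apply: (cone_scaled properC Cm (ltW e0)).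
  by lincomb; field; rewrite gt_eqF.
Qed.

(** Interior points make the two sets nonempty, [psi] bounds them by 1, and closedness of the cone
    makes the supremum and the infimum attained. *)
Lemma hilbert_bounds (x y : X) : S x -> S y ->
  [/\ 0 < hilbert_m C y x, C (y - hilbert_m C y x *: x),
    C (hilbert_M C y x *: x - y) &
    forall a b, C (y - a *: x) -> C (b *: x - y) ->
      a <= hilbert_m C y x /\ hilbert_M C y x <= b].
Proof.
move=> Sx Sy; rewrite /hilbert_m /hilbert_M /cone_le.
set A := [set a : R | C (y - a *: x)]; set B := [set b : R | C (b *: x - y)].
have [r r0 rC] := cone_interior_absorb (section_interior Sx).
have [q q0 qC] := cone_interior_absorb (section_interior Sy).
have AB a b : A a -> B b -> a <= 1 <= b.
  move=> Aa Bb; apply/andP; split.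
    by apply: (section_le Sy Sx); rewrite scale1r.
  by apply: (section_le Sx Sy); rewrite scale1r.
have small (z : X) (s : R) : 0 < s -> exists2 t : R, 0 < t & `|t *: z| < s.
  move=> s0; have z1 : 0 < `|z| + 1 by rewrite ltr_wpDl.
  exists (s / (`|z| + 1)); first exact: divr_gt0.
  rewrite normrZ gtr0_norm ?divr_gt0// mulrAC ltr_pdivrMr//.
  by rewrite ltr_pM2l// ltrDl.
have [b Bb] : exists b, B b.
  have [t t0 ty] := small (- y) r r0; exists t^-1; rewrite /B /=.
  have it : 0 <= t^-1 by rewrite invr_ge0 ltW.
  apply: (cone_scaled properC (rC _ ty) it); lincomb; field; rewrite gt_eqF//.
have [a a0 Aa] : exists2 a, 0 < a & A a.
  by have [t t0 tx] := small (- x) q q0; exists t => //; rewrite /A /= -scalerN; exact: qC.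
have supA : has_sup A.
  by split; [exists a|exists 1 => c Ac; have /andP[] := AB c b Ac Bb].
have infB : has_inf B.
  by split; [exists b|exists 1 => c Bc; have /andP[] := AB a c Aa Bc].
split.
- by apply: (lt_le_trans a0); exact: (ub_le_sup (proj2 supA) Aa).
- apply: (cone_adherent properC) => e e0.
  have x1 : 0 < `|x| + 1 by rewrite ltr_wpDl.
  have [c Ac cs] := sup_adherent (divr_gt0 e0 x1) supA.
  exists (y - c *: x) => //.
  have -> : y - c *: x - (y - sup A *: x) = (sup A - c) *: x.
    by lincomb; ring.
  have cle : c <= sup A by exact: (ub_le_sup (proj2 supA) Ac).
  rewrite normrZ ger0_norm ?subr_ge0//.
  apply: (@le_lt_trans _ _ ((sup A - c) * (`|x| + 1))).
    by rewrite ler_wpM2l ?subr_ge0// lerDl.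
  by rewrite -ltr_pdivlMr//; lra.
- apply: (cone_adherent properC) => e e0.
  have x1 : 0 < `|x| + 1 by rewrite ltr_wpDl.
  have [c Ac cs] := inf_adherent (divr_gt0 e0 x1) infB.
  exists (c *: x - y) => //.
  have -> : c *: x - y - (inf B *: x - y) = (c - inf B) *: x.
    by lincomb; ring.
  have cle : inf B <= c by exact: (ge_inf (proj2 infB) Ac).
  rewrite normrZ ger0_norm ?subr_ge0//.
  apply: (@le_lt_trans _ _ ((c - inf B) * (`|x| + 1))).
    by rewrite ler_wpM2l ?subr_ge0// lerDl.
  by rewrite -ltr_pdivlMr//; lra.
- move=> c d Ac Bd; split; first exact: (ub_le_sup (proj2 supA) Ac).
  exact: (ge_inf (proj2 infB) Bd).
Qed.

(** As the extremal coefficients are attained, those of [g x] and [g y] serve as witnesses once the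
    logarithms are removed. *)
Lemma hilbert_nonexpansive_le (G : set X) (g : X -> X) (E : R) (x y : X) :
  G `<=` S -> set_fun G S g -> hilbert_nonexpansive C G g ->
  G x -> G y -> x <=[E] y -> g x <=[E] g y.
Proof.
move=> GS gS nonexp Gx Gy xy; have [E1 _ _] := hilbert_leW (GS _ Gx) (GS _ Gy) xy.
case: xy => a [b [a0 bEa Ca Cb]].
have [m0 Cm CM /(_ a b Ca Cb)[am Mb]] := hilbert_bounds (GS _ Gx) (GS _ Gy).
have [m0' Cm' CM' _] := hilbert_bounds (gS _ Gx) (gS _ Gy).
have M1 : 1 <= hilbert_M C y x.
  by apply: (section_le (GS _ Gx) (GS _ Gy)); rewrite scale1r.
have M1' : 1 <= hilbert_M C (g y) (g x).
  by apply: (section_le (gS _ Gx) (gS _ Gy)); rewrite scale1r.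
have := nonexp _ _ Gx Gy; rewrite /hilbert_dist.
move: m0 Cm CM am Mb m0' Cm' CM' M1 M1'.
set m := hilbert_m C y x; set M := hilbert_M C y x.
set m' := hilbert_m C _ _; set M' := hilbert_M C _ _.
move=> m0 _ _ am Mb m0' Cm' CM' M1 M1'.
have M0 : 0 < M by lra.
have M0' : 0 < M' by lra.
rewrite -!ln_div ?posrE// ler_ln ?posrE ?divr_gt0// ler_pdivrMr// => Mm.
apply: (@hilbert_leE m' M') => //; apply: (le_trans Mm).
apply: ler_wpM2r; first exact: ltW.
by rewrite ler_pdivrMr//; nra.
Qed.

(* Straight segments are geodesics for the Hilbert metric. *)
Lemma hilbert_segment (v w : X) : S v -> S w -> v <> w ->
  exists (L : R) (E1 E2 : R -> R), forall t, 0 < t <= 1 ->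
    [/\ 1 < E1 t <= 1 + L * t, v <=[E1 t] (v + t *: (w - v)),
      w <=[E2 t] (v + t *: (w - v)) &
      forall E x, S x -> v <=[E] x -> w <=[E2 t] x -> E1 t <= E].
Proof.
move=> Sv Sw vw.
have [m0 Cm CM opt] := hilbert_bounds Sv Sw.
move: m0 Cm CM opt; set m := hilbert_m _ _ _; set M := hilbert_M _ _ _.
clearbody m M => m0 Cm CM opt.
have m1 : m <= 1 by apply: (section_le Sw Sv); rewrite scale1r.
have M1 : 1 <= M by apply: (section_le Sv Sw); rewrite scale1r.
have mM : m < M.
  rewrite lt_neqAle (le_trans m1 M1) andbT; apply/eqP => mM.
  have m1' : m = 1 by apply/eqP; rewrite eq_le m1 mM.
  by apply: vw; apply: (cone_antisym properC); move: Cm CM;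
    rewrite -mM m1' scale1r.
have M0 : 0 < M by lra.
(* From [m v <= w <= M v], the point at parameter [t] lies between [(1 - t + t m) v] and
   [(1 - t + t M) v]; likewise between multiples of [w], as [w / M <= v <= w / m]. [E1] and [E2] are
   the quotients of these coefficients. *)
exists ((M - m) / m), (fun t => (1 - t + t * M) / (1 - t + t * m)),
  (fun t => ((1 - t) / m + t) / ((1 - t) / M + t)) => t /andP[t0 t1].
have t1' : 0 <= 1 - t by lra.
have tm0 : 0 < t * m by exact: mulr_gt0.
have tM0 : 0 < t * M by exact: mulr_gt0.
have D1 : 0 < 1 - t + t * m by lra.
have D1' : 0 < 1 - t + t * M by lra.
have qm : 0 <= (1 - t) / m by rewrite divr_ge0// ltW.
have qM : 0 <= (1 - t) / M by rewrite divr_ge0// ltW.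
have D2 : 0 < (1 - t) / M + t by lra.
have D2' : 0 < (1 - t) / m + t by lra.
split.
- apply/andP; split; first by rewrite ltr_pdivlMr//; nra.
  rewrite ler_pdivrMr//.
  have -> : (1 + (M - m) / m * t) * (1 - t + t * m) =
      1 - t + t * M + (M - m) * t * (1 - t) * (1 - m) / m.
    by field; rewrite gt_eqF.
  rewrite lerDl divr_ge0 ?mulr_ge0 ?subr_ge0// ltW//.
- apply: (@hilbert_leE (1 - t + t * m) (1 - t + t * M)) => //.
  + by rewrite divfK// gt_eqF.
  + by apply: (cone_scaled properC Cm (ltW t0)); lincomb; ring.
  + by apply: (cone_scaled properC CM (ltW t0)); lincomb; ring.
- apply: (@hilbert_leE ((1 - t) / M + t) ((1 - t) / m + t)) => //.
  + by rewrite divfK// gt_eqF.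
  + apply: (cone_scaled properC CM qM); lincomb; field; rewrite gt_eqF//.
  + apply: (cone_scaled properC Cm qm); lincomb; field; rewrite gt_eqF//.
- move=> E x Sx vx wx.
  have [a [b [a0 bEa Ca Cb]]] := hilbert_le_trans Sv Sx Sw vx (hilbert_le_sym Sw Sx wx).
  have [am Mb] := opt a b Ca Cb.
  have [E0 _ _] := hilbert_leW Sv Sx vx.
  have [E20 _ _] := hilbert_leW Sw Sx wx.
  set E2 := ((1 - t) / m + t) / _ in bEa E20 *.
  have MEm : M <= E * E2 * m.
    by apply: (le_trans Mb); apply: (le_trans bEa); apply: ler_wpM2l => //; nra.
  (* This says [E1 t * E2 t = M / m], equality in the triangle inequality through the point of the
     segment; with [M / m <= E * E2 t] it forces [E1 t <= E]. *)
  have E2E : E2 * m * (1 - t + t * M) = M * (1 - t + t * m).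
    by rewrite /E2; field; rewrite !gt_eqF.
  rewrite ler_pdivrMr// -(ler_pM2l M0).
  have -> : M * (E * (1 - t + t * m)) = E * E2 * m * (1 - t + t * M).
    by rewrite mulrCA -E2E; ring.
  by apply: ler_wpM2r => //; exact: ltW.
Qed.

(** As [p] dominates [c x], the mixed point [s x + (1 - s) p] dominates [(s + (1 - s) c) x]. The
    errors [s (b - 1) x] and [s (1 - a) x] are therefore at most [theta (b - 1)] and [theta (1 - a)]
    times the mixed point. *)
Lemma hilbert_le_contract (s c E : R) (p x y : X) : 0 <= s < 1 -> 0 < c ->
  S p -> S x -> S y -> C (p - c *: x) -> x <=[E] y ->
  let theta := s / (s + (1 - s) * c) in
  (s *: x + (1 - s) *: p) <=[1 + theta * (E - 1)] (s *: y + (1 - s) *: p).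
Proof.
move=> /andP[s0 s1] c0 Sp Sx Sy Cp [a [b [a0 bEa Ca Cb]]] theta.
have a1 : a <= 1 by apply: (section_le Sy Sx); rewrite scale1r.
have b1 : 1 <= b by apply: (section_le Sx Sy); rewrite scale1r.
have E1 : 1 <= E by nra.
have sc : 0 < (1 - s) * c by rewrite mulr_gt0//; lra.
have th0 : 0 <= theta by rewrite divr_ge0//; lra.
have th1 : theta <= 1 by rewrite ler_pdivrMr; lra.
have D0 : s + (1 - s) * c != 0 by rewrite gt_eqF//; lra.
have thE : s * (1 - theta) = theta * ((1 - s) * c) by rewrite /theta; field.
have [thb tha] : 0 <= theta * (b - 1) /\ 0 <= theta * (1 - a).
  by split; apply: mulr_ge0; rewrite ?subr_ge0.
have Cx : C (s *: x + (1 - s) *: p - (s + (1 - s) * c) *: x).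
  have s1' : 0 <= 1 - s by lra.
  by apply: (cone_scaled properC Cp s1'); lincomb; ring.
apply: (@hilbert_leE (1 - theta * (1 - a)) (1 + theta * (b - 1))).
- have : 0 <= (1 - theta) * (1 - a) by rewrite mulr_ge0 ?subr_ge0.
  by lra.
- have : theta * b <= theta * (E * a) by exact: ler_wpM2l.
  (* What remains of the wanted inequality once [b] is replaced by its bound [E a]. *)
  suff : 0 <= theta * ((E - 1) * (1 - a) * (1 - theta)) by lra.
  by apply: mulr_ge0 => //; do 2?[apply: mulr_ge0]; rewrite subr_ge0.
- have q0 : 0 <= (1 - a) / (s + (1 - s) * c) * s.
    by rewrite mulr_ge0// divr_ge0//; lra.
  apply: (le_comb Ca Cx s0 q0); lincomb; rewrite /theta; field; done.
- have q0 : 0 <= (b - 1) / (s + (1 - s) * c) * s.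
    by rewrite mulr_ge0// divr_ge0//; lra.
  apply: (le_comb Cb Cx s0 q0); lincomb; rewrite /theta; field; done.
Qed.

End hilbert_order.

(** * Sequences, continuity and compactness in normed spaces *)

Lemma inv_nat_small (R : realType) (e : R) : 0 < e ->
  exists N, forall j, (N <= j)%N -> j.+1%:R^-1 < e.
Proof.
move=> e0; exists (Num.bound e^-1) => j Nj.
rewrite invf_plt ?posrE ?ltr0n//.
apply: (lt_le_trans (archi_boundP _)); first by rewrite invr_ge0 ltW.
by rewrite ler_nat leqW.
Qed.

Section metric_topology.
Variables (R : realType) (X : normedModType R).
Implicit Types (A B D : set X) (x y z : X).

Lemma relatively_open_ball A U x : relatively_open A U -> U x ->
  exists2 r : R, 0 < r & forall y, A y -> `|y - x| < r -> U y.
Proof.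
move=> [UA /open_subspaceP[V oV VU]] Ux.
have Vx : V x by have [] : (V `&` A) x by rewrite VU; split => //; exact: UA.
have /nbhs_ballP[r /= r0 rV] : nbhs x V by exact: open_nbhs_nbhs.
exists r => // y Ay yx.
have [] // : (U `&` A) y; rewrite -VU; split => //; apply: rV.
by rewrite -ball_normE /= distrC.
Qed.

Lemma within_continuous_dist (Y : normedModType R) A (f : X -> Y) x (e : R) :
  {within A, continuous f} -> A x -> 0 < e ->
  exists2 d : R, 0 < d & forall y, A y -> `|y - x| < d -> `|f y - f x| < e.
Proof.
move=> cf Ax e0.
have : nbhs (x : subspace A) [set t | `|f x - f t| < e].
  by move: (cf x) => /cvgrPdist_lt/(_ e e0).
rewrite /nbhs /= -(nbhs_subspace_in Ax).
move=> /nbhs_ballP[d /= d0 dA]; exists d => // y Ay yx.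
rewrite distrC; apply: dA => //.
by rewrite -ball_normE /= distrC.
Qed.

Lemma iter_continuous_dist D (f : X -> X) m x (e : R) :
  {within D, continuous f} -> 0 < e ->
  (forall i, (i < m)%N -> D (iter i f x)) ->
  exists2 d : R, 0 < d & forall y, (forall i, (i < m)%N -> D (iter i f y)) ->
    `|y - x| < d -> `|iter m f y - iter m f x| < e.
Proof.
move=> cf; elim: m e => [|m IH] e e0 Dx; first by exists e.
have [d d0 dP] := within_continuous_dist cf (Dx m (leqnn _)) e0.
have [d' d0' dP'] := IH d d0 (fun i im => Dx i (leqW im)).
exists d' => // y Dy yx /=; apply: dP; first exact: Dy.
by apply: dP' => // i im; apply: Dy; exact: leqW.
Qed.

Lemma bounded_setP A : bounded_set A <-> exists M : R, forall x, A x -> `|x| <= M.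
Proof.
split=> [[M [_ AM]]|[M AM]].
  by exists (M + 1) => x Ax; apply: AM Ax; rewrite ltrDl.
exists M; split; first exact: num_real.
by move=> r Mr x /AM xM; exact: le_trans (ltW Mr).
Qed.

Lemma bounded_setS A B : A `<=` B -> bounded_set B -> bounded_set A.
Proof.
move=> AB /bounded_setP[M BM]; apply/bounded_setP; exists M => x /AB.
exact: BM.
Qed.

Lemma compact_closure_subset A B : A `<=` B -> compact B -> compact (closure A).
Proof.
move=> AB cB; have clB := compact_closed (@norm_hausdorff _ X) cB.
apply: (subclosed_compact _ cB); first exact: closed_closure.
by rewrite [X in _ `<=` X]((closure_id B).1 clB); exact: closureS.
Qed.

(** The cluster point is approached at arbitrarily late indices, which replaces the extraction of a
    subsequence. *)
Lemma compact_seq_cluster A (x : nat -> X) : compact (closure A) ->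
  (forall j, A (x j)) ->
  exists y, forall (e : R) N, 0 < e -> exists2 j, (N <= j)%N & `|x j - y| < e.
Proof.
move=> cA Ax.
have xA : (x @ \oo) (closure A).
  by exists 0%N => // j _; exact: subset_closure.
have [y [_ yx]] := cA _ _ xA; exists y => e N e0.
have xN : (x @ \oo) (x @` [set j | (N <= j)%N]).
  by exists N => // j /= Nj; exists j.
have [z [[j Nj <-]]] := yx _ _ xN (nbhsx_ballx y e e0).
by rewrite -ball_normE /= distrC; exists j.
Qed.

(** A filter on the range together with 0 that does not cluster at 0 contains a set avoiding a ball
    around 0, hence lives on finitely many terms. *)
Lemma null_seq_compact (z : nat -> X) :
  (forall e : R, 0 < e -> exists N, forall j, (N <= j)%N -> `|z j| < e) ->
  compact (closure (range z)).
Proof.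
move=> z0; apply: (@compact_closure_subset _ (0 |` range z)) => [y ?|]; first by right.
move=> F FF FA; have [F0|] := pselect (cluster F 0); first by exists 0; split => //; left.
move=> /existsNP[P /existsNP[Q]] /not_implyP[FP] /not_implyP[].
move=> /nbhs_ballP[e /= e0 eQ] PQ.
have [N Nz] := z0 e e0.
have fin : finite_set (z @` `I_N) by exact/finite_image/finite_II.
have : F (z @` `I_N).
  apply: (filterS _ (filterI FA FP)) => y [yA Py].
  have yQ : ~ Q y by move=> Qy; apply: PQ; exists y.
  case: yA => [y0|[j _ zj]]; first by case: yQ; rewrite y0; apply: eQ; exact: ballxx.
  exists j => //=; rewrite ltnNge; apply/negP => /Nz; rewrite zj => ye.
  by apply: yQ; apply: eQ; rewrite -ball_normE /= sub0r normrN.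
move=> /(finite_compact fin)[y [[j jN zj] Fy]].
by exists y; split => //; right; exists j.
Qed.

Lemma segment_vector_compact (u : X) :
  compact [set r *: u | r in `[0, 1]%classic : set R].
Proof.
apply: continuous_compact; last exact: segment_compact.
apply: continuous_subspaceT => r.
by apply: cvgZl; exact: cvg_id.
Qed.

Lemma compact_closureE A : compact A -> compact (closure A).
Proof. exact: compact_closure_subset. Qed.

Lemma closed_norm_ball (M : R) : closed [set x : X | `|x| <= M].
Proof.
apply: (@closed_comp _ _ (fun x : X => `|x|) [set r : R | r <= M]).
  by move=> x _; exact: norm_continuous.
exact: closed_le.
Qed.

Lemma convex_norm_ball (M : R) : convex_set [set x : X | `|x| <= M].
Proof.
move=> x y l; rewrite !inE /= => xM yM.
have l0 : 0 <= (l%:num : R) by exact: ge0.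
have l1 : 0 <= 1 - (l%:num : R) by rewrite subr_ge0; exact: le1.
apply: (le_trans (ler_normD _ _)); rewrite !normrZ.
rewrite (ger0_norm l0) (@ger0_norm _ (1 - l%:num))//.
have := ler_wpM2l l0 xM; have := ler_wpM2l l1 yM; lra.
Qed.

End metric_topology.

(** * Measures of noncompactness *)

Section noncompactness_measures.
Variables (R : realType) (X : normedModType R) (nu : set X -> R).
Hypothesis nuP : homogeneous_noncompactness_measure nu.
Implicit Types (A B N : set X).

Local Notation ball1 := [set x : X | `|x| <= 1].

Lemma bounded_sumset A B : bounded_set A -> bounded_set B ->
  bounded_set [set a + b | a in A & b in B].
Proof.
move=> /bounded_setP[M AM] /bounded_setP[N BN]; apply/bounded_setP.
exists (M + N) => _ [a Aa [b Bb <-]].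
by apply: (le_trans (ler_normD _ _)); apply: lerD; [exact: AM|exact: BN].
Qed.

Lemma bounded_scale (l : R) A : bounded_set A ->
  bounded_set [set l *: a | a in A].
Proof.
move=> /bounded_setP[M AM]; apply/bounded_setP.
by exists (`|l| * M) => _ [a Aa <-]; rewrite normrZ ler_wpM2l// AM.
Qed.

Lemma bounded_ball1 : bounded_set ball1.
Proof. by apply/bounded_setP; exists 1. Qed.

Lemma bounded_hull A : bounded_set A -> bounded_set (closed_convex_hull A).
Proof.
move=> /bounded_setP[M AM]; apply/bounded_setP; exists M => x hx.
apply: (hx [set y : X | `|y| <= M]); split=> //.
by split; [exact: closed_norm_ball|exact: convex_norm_ball].
Qed.

Lemma hull_conv A x y (s : R) : A x -> A y -> 0 <= s <= 1 ->
  closed_convex_hull A (s *: x + (1 - s) *: y).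
Proof.
move=> Ax Ay /andP[s0 s1] D [[_ convD] AD].
by apply: convex_set_comb => //; exact: AD.
Qed.

Lemma ncm_add_compact A N : bounded_set A -> bounded_set N ->
  compact (closure N) -> nu [set a + b | a in A & b in N] <= nu A.
Proof.
move=> bA bN cN; apply: (le_trans (ncm_add nuP bA bN)).
by rewrite ((ncm_eq0 nuP bN).2 cN) addr0.
Qed.

Lemma ncm_contract_compact (k : R) A : bounded_set A -> k < 1 ->
  nu A <= k * nu A -> compact (closure A).
Proof.
move=> bA k1 h; apply/(ncm_eq0 nuP bA)/eqP; rewrite eq_le (ncm_ge0 nuP)// andbT.
have := ncm_ge0 nuP bA; nra.
Qed.

(** The infimum need not be attained, but being below 1 it leaves an admissible factor below 1. *)
Lemma set_contractionP (k : R) (D : set X) (f : X -> X) :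
  set_contraction nu D f k -> exists2 l : R, 0 < l < 1 &
    forall A, bounded_set A -> A `<=` D -> nu (f @` A) <= l * nu A.
Proof.
move=> [k1 _ h]; have := le_lt_trans h (_ : k%:E < 1%:E)%E.
rewrite lte_fin k1 => /(_ isT)/ereal_inf_lt[_ [l [l0 lP] <-]].
by rewrite lte_fin => l1; exists l; rewrite ?l0.
Qed.

(* The perturbation parameters [s] and [r] may depend on the point, so that [A]
   can gather orbits of a whole family of perturbed maps. *)
Lemma perturbed_orbits_compact (k : R) (U : set X) (f : X -> X) (u v : X)
    (A B : set X) :
  set_contraction nu U f k -> bounded_set B -> B `<=` U -> B `<=` A ->
  B v -> f v = v ->
  (forall x, A x -> exists y s r, [/\ B y, 0 <= s <= 1, 0 <= r <= 1 &
    x = s *: f y + (1 - s) *: v + r *: u]) ->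
  bounded_set A /\ compact (closure A).
Proof.
move=> fk bB BU BA Bv fv AP.
have [l /andP[l0 l1] lP] := set_contractionP fk.
have bf : bounded_set (f @` B) by case: fk => _ + _; exact.
pose H := closed_convex_hull (f @` B).
pose I : set X := [set r *: u | r in `[0, 1]%classic].
have bH : bounded_set H by exact: bounded_hull.
have cI : compact I by exact: segment_vector_compact.
have bI : bounded_set I by exact: compact_bounded.
(* Because [v = f v] is itself in the image of [B], the first two terms form a point of the hull
   [H]. *)
have AHI : A `<=` [set a + b | a in H & b in I].
  move=> x /AP[y [s [r [By s01 r01 ->]]]].
  exists (s *: f y + (1 - s) *: v).
    by apply: hull_conv s01; [exists y|exists v].
  by exists (r *: u) => //; exists r => //=; rewrite in_itv.
have bHI := bounded_sumset bH bI.
have bA : bounded_set A by exact: bounded_setS AHI _.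
split => //; apply: (@ncm_contract_compact l) => //.
(* The chain is [nu A <= nu H = nu (f B) <= l nu B <= l nu A]. *)
apply: (le_trans (ncm_le nuP bA bHI AHI)).
apply: (le_trans (ncm_add_compact bH bI (compact_closureE cI))).
rewrite (ncm_hull nuP)//; apply: (le_trans (lP _ bB BU)).
by apply: ler_wpM2l; [exact: ltW|exact: (ncm_le nuP bB bA)].
Qed.

(** Up to a ball of radius [e], [A] lies in [B + N] with [N] invisible to [nu]; letting [e] tend to
    0 gives [nu A <= k nu A]. *)
Lemma ncm_approx_compact (k : R) A N : bounded_set A -> k < 1 ->
  bounded_set N -> compact (closure N) ->
  (forall e : R, 0 < e -> exists B, [/\ bounded_set B, nu B <= k * nu A &
    forall x, A x -> exists b z, [/\ B b, N z & `|x - (b + z)| <= e]]) ->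
  compact (closure A).
Proof.
move=> bA k1 bN cN AP; apply: (ncm_contract_compact bA k1).
apply/ler_addgt0Pr => e e0.
have n0 := ncm_ge0 nuP bounded_ball1.
(* The added 1 keeps the denominator positive even when the unit ball has measure 0, as in finite
   dimension. *)
have n1 : 0 < nu ball1 + 1 by rewrite ltr_wpDl.
pose d := e / (nu ball1 + 1).
have d0 : 0 < d by exact: divr_gt0.
have [B [bB kB BP]] := AP d d0.
have bd := bounded_scale d bounded_ball1.
have bBN := bounded_sumset bB bN.
have ABN : A `<=` [set a + b | a in [set a + b | a in B & b in N] &
    b in [set d *: a | a in ball1]].
  move=> x /BP[b [z [Bb Nz xd]]].
  exists (b + z); first by exists b => //; exists z.
  exists (x - (b + z)); last by rewrite addrC subrK.
  exists (d^-1 *: (x - (b + z))); last by rewrite scalerA mulfV ?gt_eqF// scale1r.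
  by rewrite /= normrZ gtr0_norm ?invr_gt0// ler_pdivrMl// mulr1.
apply: (le_trans (ncm_le nuP bA (bounded_sumset bBN bd) ABN)).
apply: (le_trans (ncm_add nuP bBN bd)); apply: lerD.
  exact: le_trans (ncm_add_compact bB bN cN) kB.
rewrite (ncm_scale nuP)//; last exact: bounded_ball1.
by rewrite gtr0_norm// /d mulrAC ler_pdivrMr// ler_pM2l// lerDl.
Qed.

End noncompactness_measures.

(** * Semidifferentials and their chain rule *)

Section semidifferentials.
Variables (R : realType) (X : normedModType R).
Variable K : set X.
Hypothesis coneK : is_cone K.

Ltac lincomb := lincomb_with R.

Lemma semidifferential_approx (G : set X) (g h : X -> X) (v : X) (e : R) :
  is_semidifferential G g v K h -> 0 < e ->
  exists2 d : R, 0 < d & forall x, K x -> `|x| < d ->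
    G (v + x) /\ `|g (v + x) - g v - h x| <= e * `|x|.
Proof.
move=> [_ Gv _ _ /eqaddoP/(_ e)] + e0 => /(_ e0) gv.
have : nbhs (0 : X) [set x | K x -> G (v + x) /\
    `|g (v + x) - g v - h x| <= e * `|x|].
  move: Gv gv; rewrite !nearE /within /= => Gv gv.
  apply: (filterS _ (filterI Gv gv)) => x /= [Gx gx] Kx.
  split; first exact: Gx.
  by have := gx Kx; rewrite /= opprD addrA.
move=> /nbhs_ballP[d /= d0 dP]; exists d => // x Kx xd.
by apply: dP => //; rewrite -ball_normE /= sub0r normrN.
Qed.

Lemma unif_continuous_dist (B : set X) (h : X -> X) (e : R) :
  unif_continuous (from_subspace B h) -> 0 < e ->
  exists2 d : R, 0 < d & forall x y, B x -> B y -> `|x - y| < d ->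
    `|h x - h y| < e.
Proof.
move=> uc e0.
have [/= E entE EP] := uc _ (entourage_ball _ (PosNum e0)).
move: entE; rewrite -entourage_ballE => -[d /= d0 dE].
exists d => // x y Bx By xy.
have := EP (x, y); rewrite /= -ball_normE /=; apply; right; split => //.
by split => //; apply: dE; rewrite /= -ball_normE.
Qed.

Lemma cone0 (x : X) : K x -> K 0.
Proof. by move=> /(coneK (lexx 0)); rewrite scale0r. Qed.

Definition homogeneous_on (h : X -> X) :=
  forall (t : R) x, 0 < t -> K x -> h (t *: x) = t *: h x.

(** Homogeneity is only given for positive factors, so the value at 0 comes from
    [h 0 = h (2 *: 0) = 2 *: h 0]. *)
Lemma homogeneous_on0 (h : X -> X) x : homogeneous_on h -> K x -> h 0 = 0.
Proof.
move=> hom /cone0 K0; have := hom 2 0 (ltr0n _ 2) K0.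
by rewrite scaler0 scaler_nat mulr2n -{1}[h 0]addr0 => /addrI h0.
Qed.

Lemma homogeneous_on_iter (h : X -> X) m : set_fun K K h -> homogeneous_on h ->
  set_fun K K (iter m h) /\ homogeneous_on (iter m h).
Proof.
move=> hK hom; elim: m => [|m [IHK IH]]; first by split => [x|t x].
split=> [x Kx|t x t0 Kx] /=; first exact/hK/IHK.
by rewrite IH// hom//; exact: IHK.
Qed.

(** Continuity at 0 bounds [h] by 1 on a small ball; rescaling [x] to norm [d / 2] spreads this into
    a linear bound. *)
Lemma homogeneous_on_bound (h : X -> X) :
  {within K, continuous h} -> homogeneous_on h ->
  exists2 L : R, 0 <= L & forall x, K x -> `|h x| <= L * `|x|.
Proof.
move=> ch hom.
have [[x0 Kx0]|noK] := pselect (K !=set0); last first.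
  by exists 0 => // x Kx; case: noK; exists x.
have h0 := homogeneous_on0 hom Kx0.
have [d d0 dP] := within_continuous_dist ch (cone0 Kx0) ltr01.
exists (2 / d) => [|x Kx]; first by rewrite divr_ge0// ltW.
have [->|x_neq0] := eqVneq x 0; first by rewrite h0 !normr0 mulr0.
have nx0 : 0 < `|x| by rewrite normr_gt0.
pose s := d / (2 * `|x|).
have s0 : 0 < s by rewrite divr_gt0// mulr_gt0.
have := dP (s *: x) (coneK (ltW s0) Kx).
rewrite subr0 normrZ gtr0_norm// h0 subr0 hom// normrZ gtr0_norm//.
have -> : s * `|x| = d / 2 by rewrite /s; field; rewrite gt_eqF.
rewrite ltr_pdivrMr// ltr_pMr// ltr1n => /(_ isT)/ltW.
rewrite mulrC -ler_pdivlMr// => /le_trans; apply.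
by rewrite /s div1r invf_div [leRHS]mulrAC.
Qed.

Lemma homogeneous_on_iter_bound (h : X -> X) m : set_fun K K h ->
  {within K, continuous h} -> homogeneous_on h ->
  exists2 L : R, 0 <= L & forall x, K x -> `|iter m h x| <= L * `|x|.
Proof.
move=> hK ch hom; have [L L0 LP] := homogeneous_on_bound ch hom.
elim: m => [|m [M M0 MP]]; first by exists 1 => // x Kx; rewrite mul1r.
exists (L * M) => [|x Kx /=]; first exact: mulr_ge0.
have [mK _] := homogeneous_on_iter m hK hom.
apply: (le_trans (LP _ (mK _ Kx))).
by rewrite -mulrA ler_wpM2l// MP.
Qed.

Lemma iter_fixed (T : Type) (f : T -> T) (x : T) m : f x = x -> iter m f x = x.
Proof. by move=> fx; elim: m => //= m ->. Qed.

(** Induction on the number of iterations: [z = g^m (v + x) - v] is [h^m x + o(|x|)], and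
    [g (v + z) - v] is [h z + o(|z|)]. To compare [h z] with [h (h^m x)], divide by [|x|] and use
    uniform continuity on a bounded set. *)
Lemma semidifferential_iter (G : set X) (g h : X -> X) (v : X) (n : nat)
    (d0 : R) :
  is_semidifferential G g v K h -> set_fun K K h -> g v = v ->
  ((1 < n)%N -> unif_continuous_on_bounded K h) -> 0 < d0 ->
  (forall x, K x -> `|x| < d0 ->
    forall i, (i < n)%N -> K (iter i g (v + x) - v)) ->
  forall e : R, 0 < e -> exists2 d : R, 0 < d & forall x, K x -> `|x| < d ->
    `|iter n g (v + x) - v - iter n h x| <= e * `|x|.
Proof.
move=> sd hK gv; have [_ _ ch hom _] := sd.
case: n => [|[|n]] uc d00 gK e e0.
(* The cases 0 and 1 are settled apart, since uniform continuity is only available from 2 on. *)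
- by exists d0 => // x _ _ /=; rewrite [v + x]addrC addrK subrr normr0 mulr_ge0// ltW.
- have [d dd dP] := semidifferential_approx sd e0; exists d => // x Kx xd /=.
  by have [_] := dP x Kx xd; rewrite gv.
have {}uc := uc isT.
suff: forall m, (m <= n.+2)%N -> forall e : R, 0 < e ->
    exists2 d : R, 0 < d & forall x, K x -> `|x| < d ->
    `|iter m g (v + x) - v - iter m h x| <= e * `|x|.
  by move=> /(_ _ (leqnn _) e e0).
elim=> [|m IH] mn {e0}e e0.
  by exists d0 => // x _ _ /=; rewrite [v + x]addrC addrK subrr normr0 mulr_ge0// ltW.
have [L L0 LP] := homogeneous_on_iter_bound m hK ch hom.
have [mK mhom] := homogeneous_on_iter m hK hom.
pose B := [set x | K x /\ `|x| <= L + 1].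
have bB : bounded_set B by apply/bounded_setP; exists (L + 1) => x [].
have e2 : 0 < e / 2 by rewrite divr_gt0.
have [d1 d10 d1P] := unif_continuous_dist (uc B (fun x Bx => Bx.1) bB) e2.
have L1 : 0 < L + 1 by rewrite ltr_wpDl.
have [d2 d20 d2P] := semidifferential_approx sd (divr_gt0 e2 L1).
(* The bound 1 gives [|z| <= (L + 1) |x|], so that the rescaled points lie in [B]; the bound
   [d1 / 2] puts them at distance less than [d1]. *)
have e1 : 0 < Num.min 1 (d1 / 2) by rewrite lt_min ltr01 divr_gt0.
have [d3 d30 d3P] := IH (ltnW mn) _ e1.
exists (Num.min d0 (Num.min d3 (d2 / (L + 1)))).
  by rewrite !lt_min d00 d30 divr_gt0.
move=> x Kx; rewrite !lt_min => /and3P[xd0 xd3 xd2] /=.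
have [->|x_neq0] := eqVneq x 0.
  have h0 := homogeneous_on0 hom Kx.
  by rewrite addr0 !iter_fixed// gv h0 subrr subr0 !normr0 mulr0.
have nx0 : 0 < `|x| by rewrite normr_gt0.
set z := iter m g (v + x) - v.
have Kz : K z by exact: gK.
have zE : iter m g (v + x) = v + z by rewrite /z [RHS]addrC subrK.
have zH : `|z - iter m h x| <= Num.min 1 (d1 / 2) * `|x| by exact: d3P.
have zL : `|z| <= (L + 1) * `|x|.
  rewrite -[z](subrK (iter m h x)); apply: (le_trans (ler_normD _ _)).
  rewrite mulrDl addrC lerD ?LP// (le_trans zH)// ler_wpM2r//.
  by rewrite ge_min lexx.
have zd2 : `|z| < d2.
  by apply: (le_lt_trans zL); rewrite mulrC -ltr_pdivlMr.
have [_ gz] := d2P z Kz zd2.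
rewrite zE; have -> : g (v + z) - v - h (iter m h x) =
    (g (v + z) - g v - h z) + (h z - h (iter m h x)).
  by rewrite gv; lincomb; ring.
have ix0 : 0 < `|x|^-1 by rewrite invr_gt0.
have Bz : B (`|x|^-1 *: z).
  split; first exact: coneK (ltW ix0) Kz.
  by rewrite normrZ gtr0_norm// ler_pdivrMl// mulrC.
have Bh : B (`|x|^-1 *: iter m h x).
  split; first exact: coneK (ltW ix0) (mK _ Kx).
  rewrite normrZ gtr0_norm// ler_pdivrMl//; apply: (le_trans (LP _ Kx)).
  by rewrite mulrC ler_wpM2l// lerDl.
have := d1P _ _ Bz Bh; rewrite -scalerBr normrZ gtr0_norm//.
rewrite !hom//; last exact: mK.
rewrite -scalerBr normrZ gtr0_norm// !ltr_pdivrMl// => hh.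
apply: (le_trans (ler_normD _ _)).
have -> : e * `|x| = e / 2 * `|x| + e / 2 * `|x| by field.
apply: lerD.
  apply: (le_trans gz); rewrite mulrAC ler_pdivrMr//.
  have -> : e / 2 * `|x| * (L + 1) = e / 2 * ((L + 1) * `|x|) by ring.
  by rewrite ler_wpM2l// ltW.
rewrite [leRHS]mulrC; apply/ltW/hh.
apply: (le_lt_trans zH); rewrite mulrC ltr_pM2l//.
by rewrite gt_min; apply/orP; right; rewrite ltr_pdivrMr// ltr_pMr// ltr1n.
Qed.

End semidifferentials.

(** * Lower bound for the displacement near the fixed point *)

(** Otherwise some [x j] tend to 0 with displacement [o(|x j|)], and the unit vectors
    [y j = x j / |x j|] satisfy [y j - H (y j) -> 0]. The contraction makes them relatively compact,
    and a cluster point is a nonzero fixed point of [H]. *)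
Lemma displacement_coercive (R : realType) (X : normedModType R)
    (K U : set X) (F H : X -> X) (v : X) (nu : set X -> R) (k d0 : R) :
  is_cone K -> closed K ->
  homogeneous_on K H ->
  (forall x e, K x -> 0 < e -> exists2 d : R, 0 < d &
    forall y, K y -> `|y - x| < d -> `|H y - H x| < e) ->
  (forall e : R, 0 < e -> exists2 d : R, 0 < d & forall x, K x -> `|x| < d ->
    `|F (v + x) - v - H x| <= e * `|x|) ->
  0 < d0 -> (forall x, K x -> `|x| < d0 -> U (v + x)) ->
  homogeneous_noncompactness_measure nu -> set_contraction nu U F k ->
  (forall x, K x -> x = H x -> x = 0) ->
  exists c d : R, [/\ 0 < c, 0 < d & forall x, K x -> `|x| < d ->
    c * `|x| <= `|F (v + x) - (v + x)|].
Proof.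
move=> coneK closedK hom contH FH d00 KU nuP contr fix0.
apply: contrapT => noc.
have bad (j : nat) : exists x, [/\ K x, `|x| < j.+1%:R^-1 &
    `|F (v + x) - (v + x)| < j.+1%:R^-1 * `|x|].
  apply: contrapT => nobad; apply: noc.
  exists j.+1%:R^-1, j.+1%:R^-1; split; rewrite ?invr_gt0 ?ltr0n// => x Kx xj.
  by rewrite leNgt; apply/negP => lt; apply: nobad; exists x.
have [x /(_ _)/and3P xP] : exists x : nat -> X, forall j,
    [&& `[<K (x j)>], `|x j| < j.+1%:R^-1 &
      `|F (v + x j) - (v + x j)| < j.+1%:R^-1 * `|x j|].
  have [x xP] := choice bad; exists x => j.
  by have [Kx -> ->] := xP j; rewrite asboolT.
have Kx j : K (x j) by have [/asboolP] := xP j.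
have xj j : `|x j| < j.+1%:R^-1 by have [] := xP j.
have Fx j : `|F (v + x j) - (v + x j)| < j.+1%:R^-1 * `|x j| by have [] := xP j.
have x0 j : 0 < `|x j|.
  have := le_lt_trans (normr_ge0 _) (Fx j).
  by rewrite pmulr_rgt0// invr_gt0 ltr0n.
have ix0 j : 0 < `|x j|^-1 by rewrite invr_gt0.
pose y j := `|x j|^-1 *: x j.
have Ky j : K (y j) by apply: coneK => //; exact: ltW.
have ny j : `|y j| = 1 by rewrite normrZ gtr0_norm// mulVf// gt_eqF.
pose z j := y j - H (y j).
have z0 (e : R) : 0 < e -> exists N, forall j, (N <= j)%N -> `|z j| < e.
  move=> e0; have e2 : 0 < e / 2 by rewrite divr_gt0.
  have [d dd dP] := FH _ e2.
  have [N1 N1P] := inv_nat_small e2; have [N2 N2P] := inv_nat_small dd.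
  exists (maxn N1 N2) => j; rewrite geq_max => /andP[j1 j2].
  have -> : z j = `|x j|^-1 *: ((F (v + x j) - v - H (x j)) -
      (F (v + x j) - (v + x j))).
    by rewrite /z /y hom//; lincomb_with R; ring.
  rewrite normrZ gtr0_norm// ltr_pdivrMl//.
  apply: (le_lt_trans (ler_normB _ _)).
  have h1 := dP _ (Kx j) (lt_trans (xj j) (N2P _ j2)).
  have h2 : `|F (v + x j) - (v + x j)| < e / 2 * `|x j|.
    by apply: (lt_le_trans (Fx j)); rewrite ler_wpM2r// ltW// N1P.
  lra.
have bA : bounded_set (range y).
  by apply/bounded_setP; exists 1 => _ [j _ <-]; rewrite ny.
have [N NP] := z0 1 ltr01.
have bN : bounded_set (range z).
  have [M MP] : exists M : R, forall j, (j < N)%N -> `|z j| <= M.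
    exists (\sum_(i < N) `|z i|) => j jN.
    by rewrite (bigD1 (Ordinal jN))//= lerDl sumr_ge0.
  apply/bounded_setP; exists (Num.max M 1) => _ [j _ <-].
  rewrite le_max; case: (ltnP j N) => [/MP ->//|/NP zj].
  by rewrite (ltW zj) orbT.
have cN := null_seq_compact z0.
have [l /andP[l0 l1] lP] := set_contractionP contr.
have cA : compact (closure (range y)).
  apply: (ncm_approx_compact nuP bA l1 bN cN) => e e0.
  have [d dd dP] := FH e e0.
  (* One scale [t] serves all [j]: [H (y j)] is within [e] of [t^-1 (F (v + t y j) - v)], so the
     contraction property of [F] is used in place of one for [H], and the factors [t] and [t^-1]
     cancel. *)
  pose t := Num.min d d0 / 2.
  have dd0 : 0 < Num.min d d0 by rewrite lt_min dd d00.
  have t0 : 0 < t by rewrite divr_gt0.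
  have it0 : 0 < t^-1 by rewrite invr_gt0.
  have td : t < Num.min d d0 by rewrite ltr_pdivrMr// ltr_pMr// ltr1n.
  have ty j : `|t *: y j| < Num.min d d0.
    by rewrite normrZ ny mulr1 gtr0_norm.
  pose A1 := [set a + b | a in [set t *: a | a in range y] & b in [set v]].
  have btA := bounded_scale t bA.
  have bv u : bounded_set [set u : X].
    by apply/bounded_setP; exists `|u| => _ ->.
  have bA1 : bounded_set A1 by exact: bounded_sumset.
  have A1U : A1 `<=` U.
    move=> _ [_ [_ [j _ <-] <-] [_ -> <-]]; rewrite addrC; apply: KU.
      by apply: coneK => //; exact: ltW.
    by apply: (lt_le_trans (ty j)); rewrite ge_min lexx orbT.
  have cv u : compact (closure [set u : X]).
    by apply: compact_closureE; exact: compact_set1.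
  have bF : bounded_set (F @` A1) by case: contr => _ + _; exact.
  have bF' := bounded_scale t^-1 bF.
  exists [set a + b | a in [set t^-1 *: a | a in F @` A1] &
    b in [set - (t^-1 *: v)]]; split.
  - exact: bounded_sumset.
  - apply: (le_trans (ncm_add_compact nuP bF' (bv _) (cv _))).
    rewrite (ncm_scale nuP)// gtr0_norm// ler_pdivrMl//.
    apply: (le_trans (lP _ bA1 A1U)); rewrite mulrCA ler_pM2l//.
    apply: (le_trans (ncm_add_compact nuP btA (bv _) (cv _))).
    by rewrite (ncm_scale nuP)// gtr0_norm.
  - move=> _ [j _ <-]; exists (t^-1 *: F (v + t *: y j) + - (t^-1 *: v)), (z j).
    split; last 1 first.
    + have -> : y j - (t^-1 *: F (v + t *: y j) + - (t^-1 *: v) + z j) =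
          - (t^-1 *: (F (v + t *: y j) - v - H (t *: y j))).
        by rewrite /z (hom t (y j))//; lincomb_with R; field; rewrite gt_eqF.
      rewrite normrN normrZ gtr0_norm// ler_pdivrMl//.
      apply: (le_trans (dP _ _ _)).
      * by apply: coneK => //; exact: ltW.
      * by apply: (lt_le_trans (ty j)); rewrite ge_min lexx.
      * by rewrite normrZ ny mulr1 gtr0_norm// mulrC.
    + exists (t^-1 *: F (v + t *: y j)); last by exists (- (t^-1 *: v)).
      exists (F (v + t *: y j)) => //; exists (v + t *: y j) => //.
      by exists (t *: y j); [exists (y j) => //; exists j|exists v => //; rewrite addrC].
    + by exists j.
have [u uP] := compact_seq_cluster cA (fun j => ex_intro2 _ _ j I erefl).
have Ku : K u.
  apply: closedK => B /nbhs_ballP[e /= e0 eB].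
  have [j _ ju] := uP e 0%N e0; exists (y j); split => //.
  by apply: eB; rewrite -ball_normE /= distrC.
have uH : u = H u.
  apply/eqP; rewrite -subr_eq0 -normr_le0; apply/ler_addgt0Pr => e e0.
  rewrite add0r; have e3 : 0 < e / 3 by rewrite divr_gt0.
  have [d dd dP] := contH u _ Ku e3.
  have [M MP] := z0 _ e3.
  have m0 : 0 < Num.min d (e / 3) by rewrite lt_min dd.
  have [j Mj] := uP _ M m0; rewrite lt_min => /andP[jd je].
  have h1 := dP _ (Ky j) jd; have h2 := MP _ Mj.
  have -> : u - H u = (H (y j) - H u) - (y j - u) + z j.
    by rewrite /z; lincomb_with R; ring.
  have := ler_normD ((H (y j) - H u) - (y j - u)) (z j).
  have := ler_normB (H (y j) - H u) (y j - u).
  lra.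
(* All [y j] have norm 1, so none is at distance less than 1 from 0. *)
have [j _] := uP 1 0%N ltr01.
by rewrite (fix0 u Ku uH) subr0 ny ltxx.
Qed.

Lemma closed_level (R : realType) (X : normedModType R)
    (psi : {linear X -> R^o}) (a : R) :
  continuous psi -> closed [set x | psi x = a].
Proof.
move=> cpsi; apply: (@closed_comp _ _ (psi : X -> R^o) [set a]).
  by move=> x _; exact: cpsi.
exact: closed_eq.
Qed.

(** * Orbits of the perturbed maps *)

Section perturbed_orbits.
Variables (R : realType) (X : normedModType R) (C : set X).
Variable psi : {linear X -> R^o}.
Hypotheses (properC : proper_cone C) (psiC : dual_cone C psi).
Local Notation S := (cone_section C psi).
Local Notation "x <=[ E ] y" := (hilbert_le C E x y)
  (at level 70, E at level 200).

Variables (U D : set X) (F : X -> X) (v w : X) (delta : R).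
Hypotheses (delta0 : 0 < delta) (UD : U `<=` D) (DS : D `<=` S).
Hypothesis ballU : forall x, S x -> `|x - v| <= delta -> U x.
Hypothesis FS : forall x, U x -> S (F x).
Hypothesis F_nonexp : forall x y E, D x -> D y -> x <=[E] y -> F x <=[E] F y.
Hypotheses (Dv : D v) (Dw : D w) (Fv : F v = v) (Fw : F w = w).

Ltac lincomb := lincomb_with R.

Let p (t : R) := v + t *: (w - v).

Let perturb (t s : R) x := s *: F x + (1 - s) *: p t.

Let orbit (t s : R) i := iter i (perturb t s) (p t).

Variables (L : R) (E1 E2 : R -> R).
Hypothesis E1E2P : forall t : R, 0 < t <= 1 ->
  [/\ 1 < E1 t <= 1 + L * t, v <=[E1 t] p t, w <=[E2 t] p t &
    forall E x, S x -> v <=[E] x -> w <=[E2 t] x -> E1 t <= E].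

(* The points [x] with [d(v,x) <= d(v,p)] and [d(w,x) <= d(w,p)]: as [p] lies on
   a geodesic from [v] to [w], both are equalities, which keeps them away from
   [v]. *)
Let slice (t : R) := [set x | [/\ S x, v <=[E1 t] x & w <=[E2 t] x]].

Let Sv : S v. Proof. exact: DS. Qed.
Let Sw : S w. Proof. exact: DS. Qed.

Let slice_p t : 0 < t <= 1 -> slice t (p t).
Proof.
move=> t01; have [_ vp wp _] := E1E2P t01; split => //.
have -> : p t = t *: w + (1 - t) *: v by rewrite /p; lincomb; ring.
by apply: section_conv => //; case/andP: t01 => /ltW -> ->.
Qed.

Let slice_perturb t s x : 0 < t <= 1 -> 0 <= s <= 1 -> slice t x -> U x ->
  slice t (perturb t s x).
Proof.
move=> t01 s01 [Sx vx wx] Ux; have [Sp vp wp] := slice_p t01.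
have vFx : v <=[E1 t] F x by rewrite -Fv; apply: F_nonexp => //; exact: UD.
have wFx : w <=[E2 t] F x by rewrite -Fw; apply: F_nonexp => //; exact: UD.
split; first by apply: section_conv => //; exact: FS.
  exact: hilbert_le_conv.
exact: hilbert_le_conv.
Qed.

Let slice_orbit t s i : 0 < t <= 1 -> 0 <= s <= 1 ->
  (forall j, (j < i)%N -> `|orbit t s j - v| <= delta) -> slice t (orbit t s i).
Proof.
move=> t01 s01; elim: i => [_|i IH near]; first exact: slice_p.
have si : slice t (orbit t s i) by apply: IH => j ji; apply: near; exact: leqW.
apply: slice_perturb => //; apply: ballU; first by case: si.
exact: near.
Qed.

Variables (nu : set X -> R) (k : R).
Hypotheses (nuP : homogeneous_noncompactness_measure nu).
Hypothesis contr : set_contraction nu U F k.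

(** As [p t = v + t (w - v)], the perturbations for all [t] and [s] are displacements from [v] along
    the single segment from 0 to [w - v]. *)
Let orbits_compact (A B : set X) :
  B `<=` A -> B v -> (forall x, B x -> U x /\ `|x - v| <= delta) ->
  (forall x, A x -> [\/ x = v, exists2 t, 0 < t <= 1 & x = p t |
    exists t s y, [/\ 0 < t <= 1, 0 <= s <= 1, B y & x = perturb t s y]]) ->
  compact (closure A).
Proof.
move=> BA Bv BP AP.
apply: (perturbed_orbits_compact nuP (u := w - v) contr _ _ BA Bv Fv _).2.
- apply/bounded_setP; exists (`|v| + delta) => x /BP[_ xv].
  rewrite -[x](subrK v) addrC; apply: (le_trans (ler_normD _ _)).
  by rewrite lerD2l.
- by move=> x /BP[].
- have i01 : 0 <= (1 : R) <= 1 by rewrite ler01 lexx.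
  move=> x /AP[->|[t /andP[t0 t1] ->]|[t [s [y [/andP[t0 t1] s01 By ->]]]]].
  + exists v, 1, 0; split => //; first by rewrite lexx ler01.
    by rewrite Fv; lincomb; ring.
  + exists v, 1, t; split => //; first by rewrite (ltW t0).
    by rewrite Fv /p; lincomb; ring.
  + exists y, s, ((1 - s) * t); split => //; last first.
      by rewrite /perturb /p; lincomb; ring.
    case/andP: s01 => s0 s1.
    by rewrite mulr_ge0 ?subr_ge0 ?(ltW t0)//=; nra.
Qed.

(** Otherwise, for each [t j = 1 / (j + 1)], some orbit has a first exit point. These cluster at
    some [y], and [E1 (t j) -> 1] forces [y = v], although every exit point is at distance at least
    [delta] from [v]. *)
Lemma perturbed_orbit_stays : exists2 t : R, 0 < t <= 1 & forall (s : R) i, 0 <= s <= 1 ->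
  `|orbit t s i - v| < delta.
Proof.
apply: contrapT => nostay.
pose t (j : nat) : R := j.+1%:R^-1.
have t01 j : 0 < t j <= 1.
  by rewrite invr_gt0 ltr0n invf_le1 ?ltr0n// ler1n.
have exit j : exists si : R * nat, [/\ 0 <= si.1 <= 1,
    delta <= `|orbit (t j) si.1 si.2 - v| &
    forall i, (i < si.2)%N -> `|orbit (t j) si.1 i - v| < delta].
  apply: contrapT => noexit; apply: nostay; exists (t j) => // s i s01.
  (* Strong induction makes a violating index a first exit. *)
  elim/ltn_ind: i => i IH; rewrite ltNge; apply/negP => far.
  by apply: noexit; exists (s, i).
have [si siP] := choice exit.
pose x j i := orbit (t j) (si j).1 i.
(* [B] stops strictly before the exit, hence stays in the ball where [F] is controlled; [A] includes
   the exit point, which is one perturbed step from [B] or an initial point. *)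
pose B := [set y | y = v \/ exists j i, (i < (si j).2)%N /\ y = x j i].
pose A := [set y | y = v \/ exists j i, (i <= (si j).2)%N /\ y = x j i].
have near j i : (i < (si j).2)%N -> `|x j i - v| <= delta.
  by move=> ij; have [_ _ h] := siP j; exact/ltW/h.
have slx j i : (i <= (si j).2)%N -> slice (t j) (x j i).
  move=> ij; have [s01 _ _] := siP j; apply: slice_orbit => // l li.
  by apply: near; exact: leq_trans ij.
have cA : compact (closure A).
  apply: (@orbits_compact A B).
  - move=> _ [->|[j [i [ij ->]]]]; first by left.
    by right; exists j, i; split => //; exact: ltnW.
  - by left.
  - move=> _ [->|[j [i [ij ->]]]].
      by rewrite subrr normr0; split; [apply: ballU => //; rewrite subrr normr0|]; exact: ltW.
    split; last exact: near.
    by apply: ballU; [case: (slx j i (ltnW ij))|exact: near].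
  - move=> _ [->|[j [[|i] [ij ->]]]]; first exact: Or31.
      by apply: Or32; exists (t j).
    apply: Or33; exists (t j), (si j).1, (x j i); split => //.
      by have [] := siP j.
    by right; exists j, i.
have Ae j : A (x j (si j).2) by right; exists j, (si j).2.
have [y yP] := compact_seq_cluster cA Ae.
have close (e : R) : 0 < e -> exists j, [/\ `|x j (si j).2 - y| < e,
    `|E1 (t j) - 1| < e, C (E1 (t j) *: x j (si j).2 - v) &
    C (E1 (t j) *: v - x j (si j).2)].
  move=> e0; have L1 : 0 < `|L| + 1 by rewrite ltr_wpDl.
  have [N NP] := inv_nat_small (divr_gt0 e0 L1).
  have [j Nj xy] := yP e N e0; exists j.
  have [Sx vx _] := slx j _ (leqnn _).
  have [_ Cx Cv] := hilbert_leW properC psiC Sv Sx vx.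
  split => //; have [/andP[E11 EL] _ _ _] := E1E2P (t01 j).
  rewrite gtr0_norm ?subr_gt0//.
  have := NP j Nj; rewrite ltr_pdivlMr// -/(t j) => tL.
  have /andP[t0 _] := t01 j; have := ler_norm L; nra.
have yv : y = v.
  apply: (cone_antisym properC); apply: (cone_limit properC) => e e0;
    have [j [xy EE Cx Cv]] := close e e0.
  - by exists (x j (si j).2), v, (E1 (t j)); split => //; rewrite subrr normr0.
  - by exists v, (x j (si j).2), (E1 (t j)); split => //; rewrite subrr normr0.
have [j _] := yP delta 0%N delta0; rewrite yv ltNge.
by have [_ -> _] := siP j.
Qed.

Hypothesis F_cont : forall x e, U x -> 0 < e -> exists2 d : R, 0 < d &
  forall y, U y -> `|y - x| < d -> `|F y - F x| < e.

(** The orbit stays in the slice, where the perturbed map contracts by a ratio [theta < 1].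
    Consecutive points thus become Hilbert-close, and a cluster point is fixed by continuity. The
    lower bound [r] depends on [t] but not on [s]. *)
Lemma perturbed_fixed_point (t : R) : 0 < t <= 1 ->
  (forall (s : R) i, 0 <= s <= 1 -> `|orbit t s i - v| < delta) ->
  exists2 r : R, 0 < r & forall s, 0 <= s < 1 -> exists x,
    [/\ S x, r <= `|x - v|, `|x - v| <= delta & x = perturb t s x].
Proof.
move=> t01 stays; have [/andP[E11 _] _ _ E1opt] := E1E2P t01.
(* A value strictly between 1 and [E1 t]: a slice point too close to [v] would contradict the
   optimality of [E1 t]. *)
have Eh : 1 < (1 + E1 t) / 2 by rewrite ltr_pdivlMr//; lra.
have [rho rho0 rhoP] := hilbert_le_near properC Sv Eh.
exists (rho / 2) => [|s /andP[s0 s1]]; first by rewrite divr_gt0.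
have s01 : 0 <= s <= 1 by rewrite s0 ltW.
pose x i := orbit t s i.
have slx i : slice t (x i).
  by apply: slice_orbit => // j _; apply/ltW/stays.
have Sx i : S (x i) by case: (slx i).
have Ux i : U (x i) by apply: ballU => //; exact/ltW/stays.
have far i : rho <= `|x i - v|.
  rewrite leNgt; apply/negP => /rhoP vx; have [_ _ wx] := slx i.
  have := E1opt _ _ (Sx i) vx wx; rewrite ler_pdivlMr//; lra.
pose A := [set y | y = v \/ exists i, y = x i].
have cA : compact (closure A).
  apply: (@orbits_compact A A).
  - by [].
  - by left.
  - move=> _ [->|[i ->]]; last by split => //; exact/ltW/stays.
    by rewrite subrr normr0; split; [apply: ballU => //; rewrite subrr normr0|]; exact: ltW.
  - move=> _ [->|[[|i] ->]]; [exact: Or31|by apply: Or32; exists t|].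
    by apply: Or33; exists t, s, (x i); split => //; right; exists i.
have [u uP] := compact_seq_cluster cA (fun i => or_intror (ex_intro _ i erefl)).
(* This lower bound survives the limit and puts [u] in the interior of the cone. *)
have Cu : C (u - (E1 t)^-1 *: v).
  apply: (cone_adherent properC) => e e0.
  have [i _ xu] := uP e 0%N e0; exists (x i - (E1 t)^-1 *: v).
    have [_ vx _] := slx i; have [_ Cx _] := hilbert_leW properC psiC Sv (Sx i) vx.
    have iE : 0 <= (E1 t)^-1 by rewrite invr_ge0; lra.
    apply: (cone_scaled properC Cx iE); lincomb; field; rewrite gt_eqF//; lra.
  by rewrite opprB addrA subrK.
have Su : S u.
  split; first by apply: (cone_interior_add properC (section_interior Sv) _ Cu);
    rewrite invr_gt0; lra.
  apply: (closed_level (a := 1) psiC.1) => B /nbhs_ballP[e /= e0 eB].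
  have [i _ xu] := uP e 0%N e0; exists (x i); split; first by case: (Sx i).
  by apply: eB; rewrite -ball_normE /= distrC.
have uv : `|u - v| <= delta.
  apply/ler_addgt0Pr => e e0; have [i _ xu] := uP e 0%N e0.
  have -> : u - v = (x i - v) - (x i - u) by lincomb; ring.
  have := ler_normB (x i - v) (x i - u); have := stays s i s01.
  rewrite -/(x i); lra.
have Uu : U u by exact: ballU.
exists u; split => //.
  have r2 : 0 < rho / 2 by rewrite divr_gt0.
  have [i _ xu] := uP (rho / 2) 0%N r2.
  have := ler_normD (x i - u) (u - v).
  rewrite addrA subrK; have := far i; lra.
have [Sp vp _] := slice_p t01.
(* By the triangle inequality through [v], [EE] compares any two slice points; its inverse is the
   constant [c] of [hilbert_le_contract]. *)
pose EE := E1 t * E1 t.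
have EE1 : 1 <= EE by rewrite /EE; nra.
have comparable a b : slice t a -> slice t b -> a <=[EE] b.
  move=> [Sa va _] [Sb vb _]; apply: (hilbert_le_trans properC psiC Sa Sv Sb) => //.
  exact: (hilbert_le_sym properC psiC).
have c0 : 0 < EE^-1 by rewrite invr_gt0; lra.
have slF y : slice t y -> U y -> slice t (F y).
  move=> sy Uy; have i01 : 0 <= (1 : R) <= 1 by rewrite ler01 lexx.
  have := slice_perturb t01 i01 sy Uy.
  by rewrite /perturb subrr scale0r addr0 scale1r.
have Cp y : slice t y -> C (p t - EE^-1 *: y).
  move=> sy; have [Sy _ _] := sy.
  have [_ Cpy _] := hilbert_leW properC psiC Sy Sp (comparable _ _ sy (slice_p t01)).
  apply: (cone_scaled properC Cpy (ltW c0)); lincomb; field; rewrite gt_eqF//; lra.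
pose theta := s / (s + (1 - s) * EE^-1).
have sc : 0 < (1 - s) * EE^-1 by rewrite mulr_gt0//; lra.
have th0 : 0 <= theta by rewrite divr_ge0//; lra.
have th1 : theta < 1 by rewrite ltr_pdivrMr; lra.
have step i : x i <=[1 + theta ^+ i * (EE - 1)] x i.+1.
  elim: i => [|i IH].
    by rewrite expr0 mul1r addrC subrK; exact: comparable.
  have FE := F_nonexp (UD (Ux i)) (UD (Ux i.+1)) IH.
  have s01' : 0 <= s < 1 by rewrite s0.
  have := hilbert_le_contract properC psiC s01' c0 Sp (FS (Ux i)) (FS (Ux i.+1))
    (Cp _ (slF _ (slx i) (Ux i))) FE.
  rewrite /= -/theta; congr hilbert_le; rewrite exprS; ring.
have geo (e : R) : 0 < e -> exists N, forall i, (N <= i)%N ->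
    theta ^+ i * (EE - 1) < e.
  move=> e0; have : `|theta| < 1 by rewrite ger0_norm.
  move=> /(@cvg_geometric _ (EE - 1))/cvgrPdist_lt/(_ e e0)[N _ NP].
  exists N => i /NP; rewrite sub0r normrN /geometric /= => lt.
  by rewrite mulrC; exact: le_lt_trans (ler_norm _) lt.
(* The pair of consecutive points is near [u] and its perturbed image, with ratio near 1; the limits
   of both order inequalities identify the two. *)
have close (e : R) : 0 < e -> exists i E, [/\ `|x i - u| < e,
    `|x i.+1 - perturb t s u| < e, `|E - 1| < e,
    C (E *: x i - x i.+1) & C (E *: x i.+1 - x i)].
  move=> e0; have [d d0 dP] := F_cont Uu e0; have [N NP] := geo e e0.
  have de0 : 0 < Num.min d e by rewrite lt_min d0.
  have [i Ni] := uP _ N de0; rewrite lt_min => /andP[xd xe].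
  have [E1' CE CE'] := hilbert_leW properC psiC (Sx i) (Sx i.+1) (step i).
  exists i, (1 + theta ^+ i * (EE - 1)); split => //.
    have -> : x i.+1 - perturb t s u = s *: (F (x i) - F u).
      by rewrite /x /orbit iterS /perturb -/(orbit t s i); lincomb; ring.
    rewrite normrZ ger0_norm//; apply: le_lt_trans (dP _ (Ux i) xd).
    by rewrite ler_piMl// ltW.
  rewrite addrAC subrr add0r ger0_norm; first exact: NP.
  by rewrite mulr_ge0 ?exprn_ge0 ?subr_ge0.
apply: (cone_antisym properC); apply: (cone_limit properC) => e e0;
  have [i [E [xu yu EE' C1 C2]]] := close e e0.
- by exists (x i), (x i.+1), E.
- by exists (x i.+1), (x i), E.
Qed.

End perturbed_orbits.

(** * Uniqueness of the fixed point *)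

Lemma iter_domP (T : Type) (G : set T) (g : T -> T) n x : (0 < n)%N ->
  iter_dom G g n x <-> forall i, (i < n)%N -> G (iter i g x).
Proof.
move=> n0; split=> [[Gx Gi] [|i] //= i_n|Gi]; first exact: (Gi i.+1).
by split=> [|i /andP[_]]; [exact: (Gi 0%N)|exact: Gi].
Qed.

Theorem theorem8p4 (R : realType) (X : completeNormedModType R)
  (C : set X) (psi : {linear X -> R^o}) (G : set X) (g : X -> X) (v : X)
  (n : nat) (h : X -> X) (U : set X) (nu : set X -> R) (k : R)
  (Sigma := cone_section C psi) (K := [set x : X | psi x = 0])
  (properC : proper_cone C) (intC : C° !=set0)
  (psiC : dual_cone C psi) (psi_neq0 : psi <> \0 :> (X -> R^o))
  (openG : relatively_open Sigma G)
  (g_Sigma : set_fun G Sigma g)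
  (g_cont : {within G, continuous g})
  (g_nonexp : hilbert_nonexpansive C G g)
  (Gv : G v) (gv : g v = v)
  (n_gt0 : (0 < n)%N)
  (A1 : is_semidifferential G g v K h) (A1_fun : set_fun K K h)
  (A2_open : relatively_open Sigma U) (A2_v : U v) (A2_sub : U `<=` G)
  (A2_dom : U `<=` iter_dom G g n)
  (A2_nu : homogeneous_noncompactness_measure nu)
  (A2_contr : set_contraction nu U (iter n g) k)
  (A2_unif : (1 < n)%N -> unif_continuous_on_bounded K h)
  (A3 : forall x : X, K x -> x = iter n h x -> x = 0) :
  [set w | iter_dom G g n w /\ iter n g w = w] = [set v] /\
  [set w | G w /\ g w = w] = [set v].
Proof.
(* A fixed point of [g] in [G] is one of [g^n] with its whole orbit in [G], so one claim gives both
   equalities. *)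
suff main w : iter_dom G g n w -> iter n g w = w -> w = v.
  split; apply/seteqP; split=> w.
  - by move=> [Gw gw]; exact: main.
  - move=> /= ->; split; last exact: iter_fixed.
    by apply/(iter_domP _ _ _ n_gt0) => i _; rewrite iter_fixed.
  - move=> [Gw gw]; apply: main; last exact: iter_fixed.
    by apply/(iter_domP _ _ _ n_gt0) => i _; rewrite iter_fixed.
  - by move=> /= ->.
move=> Dw Fw; apply: contrapT => /nesym vw.
pose F := iter n g.
have [GS _] := openG.
have Sv : Sigma v by exact: GS.
have domP x := iter_domP G g x n_gt0.
have Dv : iter_dom G g n v by exact: A2_dom.
have DS : iter_dom G g n `<=` Sigma by move=> x []/GS.
have iterS_dom x i : iter_dom G g n x -> (i <= n)%N -> Sigma (iter i g x).
  move=> /domP Dx; case: i => [|i] i_n; first exact/GS/(Dx 0%N).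
  by rewrite iterS; apply: g_Sigma; exact: Dx.
have F_nonexp x y E : iter_dom G g n x -> iter_dom G g n y ->
    hilbert_le C E x y -> hilbert_le C E (F x) (F y).
  move=> /domP Dx /domP Dy xy.
  suff: forall m, (m <= n)%N -> hilbert_le C E (iter m g x) (iter m g y) by exact.
  elim=> [//|m IH] mn; rewrite !iterS.
  apply: (hilbert_nonexpansive_le properC psiC GS g_Sigma g_nonexp).
  - exact: Dx.
  - exact: Dy.
  - exact/IH/ltnW.
have psiv : psi v = 1 by case: Sv.
have KB x : Sigma x -> K (x - v).
  by move=> [_ /= x1]; rewrite /K /= linearB /= x1 psiv subrr.
have coneK : is_cone K.
  by move=> t x _; rewrite /K /= linearZ /= => ->; rewrite scaler0.
have closedK : closed K by exact: closed_level psiC.1.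
have [r r0 rU] := relatively_open_ball A2_open A2_v.
have [d0 d00 d0U] : exists2 d0 : R, 0 < d0 &
    forall x, K x -> `|x| < d0 -> U (v + x).
  have : nbhs v (C°).
    by apply: open_nbhs_nbhs; split; [exact: open_interior|case: Sv].
  move=> /nbhs_ballP[q /= q0 qC]; exists (Num.min q r); first by rewrite lt_min q0.
  move=> x Kx; rewrite lt_min => /andP[xq xr]; apply: rU.
    split; first by apply: qC; rewrite -ball_normE /= opprD addNKr normrN.
    by rewrite /= linearD /= psiv (Kx : psi x = 0) addr0.
  by rewrite [v + x]addrC addrK.
have [_ _ ch hom _] := A1.
have [HK Hhom] := homogeneous_on_iter n A1_fun hom.
have approx := semidifferential_iter coneK A1 A1_fun gv A2_unif d00.
have {}approx : forall e : R, 0 < e -> exists2 d : R, 0 < d &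
    forall x, K x -> `|x| < d -> `|F (v + x) - v - iter n h x| <= e * `|x|.
  apply: approx => x Kx xd i i_n; apply: KB; apply: iterS_dom (ltnW i_n).
  exact/A2_dom/d0U.
have H_cont x (e : R) : K x -> 0 < e -> exists2 d : R, 0 < d &
    forall y, K y -> `|y - x| < d -> `|iter n h y - iter n h x| < e.
  move=> Kx e0.
  have hK m y : K y -> K (iter m h y).
    by move=> Ky; elim: m => //= m; exact: A1_fun.
  have [d dd dP] := iter_continuous_dist (m := n) ch e0 (fun i _ => hK i x Kx).
  by exists d => // y Ky; apply: dP => i _; exact: hK.
have [c [d [c_gt0 d_gt0 coercive]]] :=
  displacement_coercive coneK closedK Hhom H_cont approx d00 d0U A2_nu A2_contr
    A3.
have F_cont x (e : R) : U x -> 0 < e -> exists2 d : R, 0 < d &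
    forall y, U y -> `|y - x| < d -> `|F y - F x| < e.
  move=> /A2_dom/domP Dx e0.
  have [d1 d10 dP] := iter_continuous_dist g_cont e0 Dx.
  by exists d1 => // y /A2_dom/domP Dy; exact: dP.
(* Below [r], so that the ball lies in [U], and below [d], so that the displacement bound holds on
   it. *)
pose delta := Num.min r d / 2.
have rd0 : 0 < Num.min r d by rewrite lt_min r0.
have delta0 : 0 < delta by rewrite divr_gt0.
have deltard : delta < Num.min r d by rewrite ltr_pdivrMr// ltr_pMr// ltr1n.
have /andP[delta_r delta_d] : (delta < r) && (delta < d) by rewrite -lt_min.
have ballU x : Sigma x -> `|x - v| <= delta -> U x.
  by move=> Sx xv; apply: rU => //; exact: le_lt_trans delta_r.
have FS x : U x -> Sigma (F x) by move=> /A2_dom Dx; exact: iterS_dom.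
have Fv : F v = v by exact: iter_fixed.
have [L [E1 [E2 E1E2P]]] := hilbert_segment properC psiC Sv (DS _ Dw) vw.
have [t t01 stays] := perturbed_orbit_stays properC psiC delta0 A2_dom DS
  ballU FS F_nonexp Dv Dw Fv Fw E1E2P A2_nu A2_contr.
have [rho rho0 fixP] := perturbed_fixed_point properC psiC delta0 A2_dom DS
  ballU FS F_nonexp Dv Dw Fv Fw E1E2P A2_nu A2_contr F_cont t01 stays.
pose q := c * rho.
have q0 : 0 < q by exact: mulr_gt0.
(* The solution of [(1 - s) (2 delta) = s (q / 2)]: the displacement of the perturbed fixed point is
   then at most [q / 2], while coercivity makes it at least [q]. *)
pose s := 2 * delta / (2 * delta + q / 2).
have D0 : 0 < 2 * delta + q / 2 by lra.
have s01 : 0 <= s < 1.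
  by rewrite divr_ge0 ?ltr_pdivrMr//; lra.
have [x [Sx rx xd xE]] := fixP s s01.
have /andP[s0 s1] := s01.
(* The orbit at index 0 is the base point of the perturbation itself. *)
have pv : `|v + t *: (w - v) - v| < delta.
  by apply: (stays 0 0%N); rewrite lexx ler01.
have := coercive (x - v) (KB _ Sx) (le_lt_trans xd delta_d).
rewrite [v + (x - v)]addrC subrK => cx.
(* The fixed point equation, with [x] and the base point both measured from [v], each within [delta]
   of it. *)
have sE : s *: (F x - x) = (1 - s) *: ((x - v) - (v + t *: (w - v) - v)).
  suff -> : s *: (F x - x) = (s *: F x + (1 - s) *: (v + t *: (w - v))) - x
      + (1 - s) *: (x - (v + t *: (w - v))).
    by rewrite -xE subrr add0r; congr (_ *: _); lincomb_with R; ring.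
  by lincomb_with R; ring.
have : s * `|F x - x| <= (1 - s) * (2 * delta).
  rewrite -[s in leLHS]ger0_norm// -normrZ sE normrZ ger0_norm ?subr_ge0 ?(ltW s1)//.
  rewrite ler_wpM2l ?subr_ge0 ?(ltW s1)//.
  by apply: (le_trans (ler_normB _ _)); rewrite mulr_natl mulr2n lerD// ltW.
have qF : q <= `|F x - x|.
  by apply: le_trans cx; rewrite /q ler_wpM2l// ltW.
have sq : (1 - s) * (2 * delta) = s * (q / 2).
  have frac (a b : R) : a + b != 0 -> (1 - a / (a + b)) * a = a / (a + b) * b.
    by move=> ab; field.
  by apply: frac; rewrite gt_eqF.
have s_gt0 : 0 < s by rewrite divr_gt0//; lra.
rewrite sq ler_pM2l//; lra.
Qed.
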